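(* Let $n\ge3$, let $A\subseteq\mathbb{R}$ be a compact interval, $0<b\le1$, and let $g:A\times[0,b]\to\mathbb{R}$ be nondegenerate near the origin. For $a\in A$ and $\varepsilon\in(0,b]$ let $$\Gamma_{a,\varepsilon}=\{(X,g(a,|X|))\in\mathbb{R}^{n-1}\times\mathbb{R}:|X|\le\varepsilon\}.$$ Then there exist $\varepsilon\in(0,b]$ and $C>0$, with $\varepsilon^{-1}$ and $C$ bounded by constants depending only on $n$, $b$, $\|g\|_{\mathrm{reg}}$, $L$, $\inf_{A\times[0,b]}|g_{tt}|$ and $\lambda_2$, such that for all $a,\bar a\in A$, $$\sup_{\tau\in\mathbb{R}^n}\big|(\Gamma_{a,b}(\delta)+\tau)\cap\Gamma_{\bar a,\varepsilon}(\delta)\big|\le C\,\frac{\delta^2}{\delta+|\bar a-a|}\qquad\text{for all }\delta\in(0,1).$$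
   Context: Subscripts denote partial derivatives of $g(a,t)$. With $I=[0,b]$, put $\|g\|_\infty=\sup_{A\times I}|g|$, $\|g\|_{\mathrm{Lip}}=\sup_{(\bar a,\bar t)\neq(a,t)\in A\times I}\frac{|g(\bar a,\bar t)-g(a,t)|}{|\bar a-a|+|\bar t-t|}$, and $\|g\|_{\mathrm{reg}}=\|g_t\|_\infty+\|g_t\|_{\mathrm{Lip}}+\|g_{tt}\|_{\mathrm{Lip}}$ (finiteness includes the existence of $g_t,g_{tt}$ on $A\times I$). A function $g:A\times[0,b]\to\mathbb{R}$ (with $A$ a compact interval, $0<b\le1$, $I=[0,b]$) is nondegenerate near the origin if: (a) $\|g\|_{\mathrm{reg}}<\infty$ and there is a constant $L>0$ such that for all $(a,t),(\bar a,\bar t)\in A\times I$, $|(g_{tt}(\bar a,\bar t)-g_{tt}(a,\bar t))-(g_{tt}(\bar a,t)-g_{tt}(a,t))|\le L|\bar a-a||\bar t-t|$; (b) $g_t(a,0)=0$ for all $a\in A$; (c) $g_{tt}(a,t)\ne0$ for all $(a,t)\in A\times I$, and $\lambda_2:=\inf_{t\in I}\inf_{\bar a\ne a\in A}\left|\frac{g_{tt}(\bar a,t)-g_{tt}(a,t)}{\bar a-a}\right|>0$. For $E\subseteq\mathbb{R}^n$, $E(\delta)=\{x+y:x\in E,\ |y|<\delta\}$ and $|E|$ denotes Lebesgue measure. *)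

(* Defs.v *)
From mathcomp Require Import all_boot all_order all_algebra.
From mathcomp Require Import all_classical all_reals all_analysis.

Set Implicit Arguments.
Unset Strict Implicit.
Unset Printing Implicit Defensive.

Import Order.TTheory GRing.Theory Num.Theory.
Import numFieldNormedType.Exports.

Local Open Scope classical_set_scope.
Local Open Scope ring_scope.

Section derivative_on_a_set.
Context {R : realType}.
Implicit Types (D : set R) (f : R -> R) (h : R -> R -> R).

(* Derivatives relative to D, one-sided at the endpoints when D is a segment:
   values of f outside D play no role. *)
Definition diff_quot_within D f (t : R) : set_system R :=
  (fun s => (f s - f t) / (s - t)) @ within D t^'.

Definition derivable_within D f (t : R) : Prop := cvg (diff_quot_within D f t).

Definition derive_within D f (t : R) : R := lim (diff_quot_within D f t).

Definition partial_t D h : R -> R -> R := fun a => derive_within D (h a).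

End derivative_on_a_set.

Section norms.
Context {R : realType}.
Implicit Types (A D : set R) (h : R -> R -> R).

Definition sup_norm A D h : \bar R :=
  ereal_sup [set `|h p.1 p.2|%:E | p in A `*` D].

Definition inf_abs A D h : \bar R :=
  ereal_inf [set `|h p.1 p.2|%:E | p in A `*` D].

Definition lip_norm A D h : \bar R :=
  ereal_sup [set z : \bar R | exists p q : R * R,
    [/\ (A `*` D) p, (A `*` D) q, q <> p &
        z = (`|h q.1 q.2 - h p.1 p.2| /
             (`|q.1 - p.1| + `|q.2 - p.2|))%:E]].

Definition reg_norm A D (g : R -> R -> R) : \bar R :=
  (sup_norm A D (partial_t D g) + lip_norm A D (partial_t D g)
   + lip_norm A D (partial_t D (partial_t D g)))%E.

(* Equal to +oo when A is a single point. *)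
Definition lambda2 A D (g : R -> R -> R) : \bar R :=
  let gtt := partial_t D (partial_t D g) in
  ereal_inf [set z : \bar R | exists t a a' : R,
    [/\ D t, A a, A a', a' <> a &
        z = `|(gtt a' t - gtt a t) / (a' - a)|%:E]].

End norms.

(* L is the constant of the mixed-difference bound; it is a parameter because
   the quantitative bounds are allowed to depend on it. *)
Definition nondegenerate_near_origin {R : realType} (A : set R) (b : R)
    (g : R -> R -> R) (L : R) : Prop :=
  let I : set R := `[0, b]%classic in
  let gt := partial_t I g in
  let gtt := partial_t I gt in
  [/\ [/\ forall a t, A a -> I t -> derivable_within I (g a) t,
           forall a t, A a -> I t -> derivable_within I (gt a) t,
           (reg_norm A I g < +oo)%E,
           0 < L &
           forall a a' t t', A a -> A a' -> I t -> I t' ->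
             `|(gtt a' t' - gtt a t') - (gtt a' t - gtt a t)|
               <= L * `|a' - a| * `|t' - t|],
      forall a, A a -> gt a 0 = 0 &
      (forall a t, A a -> I t -> gtt a t <> 0) /\ (0 < lambda2 A I g)%E].

Section euclidean_space.
Context {R : realType}.

(* The library's norm on 'rV_n is the sup norm, hence this definition. *)
Definition enorm (n : nat) (x : 'rV[R]_n) : R :=
  Num.sqrt (\sum_(i < n) x ord0 i ^+ 2).

Definition nbhd (n : nat) (E : set 'rV[R]_n) (delta : R) : set 'rV[R]_n :=
  [set z | exists x y, [/\ E x, enorm y < delta & z = x + y]].

Definition translate (n : nat) (E : set 'rV[R]_n) (tau : 'rV[R]_n) :
    set 'rV[R]_n :=
  [set x + tau | x in E].

Definition box (n : nat) (l u : 'rV[R]_n) : set 'rV[R]_n :=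
  [set x | forall i, l ord0 i <= x ord0 i <= u ord0 i].

Definition box_volume (n : nat) (l u : 'rV[R]_n) : R :=
  \prod_(i < n) (u ord0 i - l ord0 i).

(* n-dimensional Lebesgue outer measure (infimum of the total volumes of
   countable covers by closed boxes), which is Lebesgue measure on measurable
   sets, in particular on open sets such as the neighbourhoods nbhd E delta. *)
Definition lebesgue_rV (n : nat) (E : set 'rV[R]_n) : \bar R :=
  ereal_inf [set v : \bar R | exists l u : nat -> 'rV[R]_n,
    [/\ forall k i, l k ord0 i <= u k ord0 i,
        E `<=` \bigcup_k box (l k) (u k) &
        v = (\sum_(0 <= k <oo) (box_volume (l k) (u k))%:E)%E]].

(* R^n is R^(n-1) x R, i.e. 'rV_(n.-1 + 1), which has dimension n for n >= 1. *)
Definition Gamma (n : nat) (g : R -> R -> R) (a eps : R) :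
    set 'rV[R]_(n.-1 + 1) :=
  [set row_mx X (const_mx (g a (enorm X))) | X in
    [set X : 'rV[R]_n.-1 | enorm X <= eps]].

End euclidean_space.

Arguments Gamma {R} n g a eps.

(* Main.v *)
Require Import Defs.
From mathcomp Require Import all_boot all_order all_algebra.
From mathcomp Require Import all_classical all_reals all_analysis.
From mathcomp Require Import ring lra.
Import Order.TTheory GRing.Theory Num.Theory.
Import numFieldNormedType.Exports.
Local Open Scope classical_set_scope.
Local Open Scope ring_scope.

Set Implicit Arguments.
Unset Strict Implicit.
Unset Printing Implicit Defensive.

(* Write q = |a' - a|, G_a(x) = g(a, |x|), and split the translation into its
   horizontal part tau and vertical part tau_n. A point of the intersection
   lies over some z with |z| <= eps and |H(z)| = O(delta), where
   H(z) = G_a'(z) - G_a(z - tau) - tau_n, and within O(delta) of the graph of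
   G_a', so everything reduces to a sublevel estimate for H on R^(n-1).

   The Bregman divergence D_G(w, z) = G(w) - G(z) - <grad G(z), w - z> of a
   radial function is an explicit combination of one-variable Taylor
   remainders. Hence D_{G_a} is comparable to |w - z|^2, the divergences of
   G_a' and G_a differ by a definite sign times lambda_2 q |w - z|^2 / 2, and
   translating D_{G_a} by tau costs at most a multiple of |tau| |w - z|^2.

   If |tau| is at least a large multiple of eps q, then |grad H| >= c |tau|
   dominates the divergence of H on the eps-ball. Otherwise, for eps small, H
   or - H is uniformly convex with constant c q. In the convex case take z0
   in the sublevel set with almost minimal gradient g0: if g0^2 <= delta q the
   sublevel set lies in a ball of radius O(sqrt (delta / q)), and n - 1 >= 2 is
   enough; otherwise it lies in a ball of radius O(g0 / q) on which
   |grad H| >= g0 / 2.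

   Wherever |grad H| >= rho, splitting according to a coordinate i with
   |d_i H| >= rho / (n - 1) makes the sublevel set have extent O(delta / rho)
   in direction i, and slicing the other coordinates into slabs of width delta
   produces an explicit finite cover by boxes. *)

(** * Finite covers by boxes *)

(** Finitely many boxes, each given by its two corners, keep the volume count a finite sum in [R];
    the extended-real series of [lebesgue_rV] enters only in [fin_cover_lebesgue]. *)
Definition fin_cover {R : realType} {n : nat} (E : set 'rV[R]_n) (v : R) :=
  exists s : seq ('rV[R]_n * 'rV[R]_n),
    [/\ forall p, p \in s -> forall i, p.1 ord0 i <= p.2 ord0 i,
        forall x, E x -> exists2 p, p \in s & box p.1 p.2 x &
        \sum_(p <- s) box_volume p.1 p.2 <= v].

Lemma fin_cover_le {R : realType} {n : nat} (E : set 'rV[R]_n) (v w : R) :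
  v <= w -> fin_cover E v -> fin_cover E w.
Proof. by move=> vw [s [h1 h2 h3]]; exists s; split=> //; exact: le_trans vw. Qed.

Lemma fin_cover_sub {R : realType} {n : nat} (E F : set 'rV[R]_n) (v : R) :
  E `<=` F -> fin_cover F v -> fin_cover E v.
Proof. by move=> EF [s [h1 h2 h3]]; exists s; split=> // x /EF /h2. Qed.

Lemma fin_cover0 {R : realType} {n : nat} (E : set 'rV[R]_n) (v : R) :
  0 <= v -> ~ (E !=set0) -> fin_cover E v.
Proof.
move=> v0 E0; exists [::]; split=> // [x Ex|]; last by rewrite big_nil.
by case: E0; exists x.
Qed.

Lemma fin_cover_seq {R : realType} {n : nat} {T : eqType} (s : seq T)
    (E : T -> set 'rV[R]_n) (v : R) :
  (forall k, k \in s -> fin_cover (E k) v) ->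
  fin_cover [set x | exists2 k, k \in s & E k x] ((size s)%:R * v).
Proof.
elim: s => [|k s IH] h.
  by rewrite mul0r; apply: fin_cover0 => // -[x [k]].
have [|s1 [a1 a2 a3]] := IH; first by move=> j js; apply: h; rewrite inE js orbT.
have [|s2 [b1 b2 b3]] := h k; first by rewrite inE eqxx.
exists (s2 ++ s1); split=> [p|x [j]|].
- by rewrite mem_cat => /orP[/b1|/a1].
- rewrite inE => /orP[/eqP -> /b2[p ps px]|js jx].
    by exists p => //; rewrite mem_cat ps.
  have [|p ps px] := a2 x; first by exists j.
  by exists p => //; rewrite mem_cat ps orbT.
- by rewrite big_cat /= -natr1 mulrDl mul1r addrC lerD.
Qed.

(** One box suffices, centred at an arbitrary point of [E] with half-widths [e i]; hence the factor
    2. *)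
Lemma fin_cover_extent {R : realType} {n : nat} (E : set 'rV[R]_n)
    (e : 'I_n -> R) :
  (forall i, 0 <= e i) ->
  (forall x y, E x -> E y -> forall i, `|x ord0 i - y ord0 i| <= e i) ->
  fin_cover E (\prod_i (2 * e i)).
Proof.
move=> e0 h; have [[x Ex]|E0] := pselect (E !=set0); last first.
  by apply: fin_cover0 E0; apply: prodr_ge0 => i _; rewrite mulr_ge0.
exists [:: (\row_i (x ord0 i - e i), \row_i (x ord0 i + e i))]; split.
- move=> p; rewrite inE => /eqP -> /= i; rewrite !mxE.
  by have := e0 i; lra.
- move=> y Ey; exists (\row_i (x ord0 i - e i), \row_i (x ord0 i + e i)).
    by rewrite inE.
  move=> i /=; rewrite !mxE.
  by have := h _ _ Ey Ex i; rewrite ler_norml; lra.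
- rewrite big_seq1 /box_volume le_eqVlt; apply/orP; left; apply/eqP.
  by apply: eq_bigr => i _; rewrite !mxE; ring.
Qed.

Lemma fin_cover_slice {R : realType} {n : nat} (E : set 'rV[R]_n) (i : 'I_n)
    (c delta v : R) :
  0 < delta -> 0 <= c -> 0 <= v ->
  (forall x y, E x -> E y -> `|x ord0 i - y ord0 i| <= c) ->
  (forall F : set 'rV[R]_n, F `<=` E ->
    (forall x y, F x -> F y -> `|x ord0 i - y ord0 i| <= delta) ->
    fin_cover F v) ->
  fin_cover E ((2 * c / delta + 1) * v).
Proof.
move=> d0 c0 v0 h H.
have cd0 : 0 <= 2 * c / delta by rewrite divr_ge0 ?mulr_ge0 // ltW.
have [[e Ee]|E0] := pselect (E !=set0); last first.
  by apply: fin_cover0 => //; rewrite mulr_ge0 ?addr_ge0.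
(* Adding [c] makes [pos] nonnegative on [E], so its truncation can index the slabs; [pos] is at
   most [2 * c / delta], hence [m] slabs. *)
pose pos (x : 'rV[R]_n) := (x ord0 i - e ord0 i + c) / delta.
pose F (k : nat) := [set x | E x /\ k%:R <= pos x < k.+1%:R].
pose m := (Num.truncn (2 * c / delta)).+1.
apply: (@fin_cover_le _ _ _ ((size (iota 0 m))%:R * v)).
  by rewrite size_iota ler_wpM2r // /m -natr1 lerD2r truncn_le.
apply: (@fin_cover_sub _ _ _ [set x | exists2 k, k \in iota 0 m & F k x]).
  move=> x Ex; have := h _ _ Ex Ee; rewrite ler_norml => /andP[hx1 hx2].
  have p0 : 0 <= pos x by rewrite divr_ge0 ?(ltW d0) //; lra.
  exists (Num.truncn (pos x)); last by split=> //; exact: truncn_itv.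
  rewrite mem_iota /= add0n ltnS le_truncn // /pos.
  by rewrite ler_pM2r ?invr_gt0 //; lra.
apply: fin_cover_seq => k _; apply: H => [x []//|x y [_ hx] [_ hy]].
have -> : x ord0 i - y ord0 i = (pos x - pos y) * delta.
  by rewrite /pos; field; rewrite gt_eqF.
rewrite normrM (gtr0_norm d0) ler_piMl ?(ltW d0) // ler_norml.
by move: hx hy; rewrite -natr1; lra.
Qed.

Lemma fin_cover_slices {R : realType} {n : nat} (J : seq 'I_n)
    (E : set 'rV[R]_n) (c delta v : R) :
  0 < delta -> 0 <= c -> 0 <= v ->
  (forall x y, E x -> E y -> forall i, i \in J ->
    `|x ord0 i - y ord0 i| <= c) ->
  (forall F : set 'rV[R]_n, F `<=` E ->
    (forall x y, F x -> F y -> forall i, i \in J ->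
      `|x ord0 i - y ord0 i| <= delta) ->
    fin_cover F v) ->
  fin_cover E ((2 * c / delta + 1) ^+ size J * v).
Proof.
move=> d0 c0 v0; elim: J E => [|j J IH] E h H.
  by rewrite expr0 mul1r; apply: H.
have cd0 : 0 <= 2 * c / delta + 1.
  by rewrite addr_ge0 ?divr_ge0 ?mulr_ge0 // ltW.
rewrite /= exprS -mulrA; apply: (@fin_cover_slice _ _ _ j) => //.
- by rewrite mulr_ge0 // exprn_ge0.
- by move=> x y Ex Ey; apply: h => //; rewrite inE eqxx.
move=> F FE Fj; apply: IH => [x y /FE Ex /FE Ey i iJ|F' F'F hF'].
  by apply: h => //; rewrite inE iJ orbT.
apply: H => [x /F'F /FE //|x y Fx Fy i]; rewrite inE => /orP[/eqP ->|iJ].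
  by apply: Fj; apply: F'F.
exact: hF'.
Qed.

(** The finite cover is padded to a countable one by the box reduced to the origin. Its volume
    vanishes because [0 < n]; an empty product would be 1. *)
Lemma fin_cover_lebesgue {R : realType} {n : nat} (E : set 'rV[R]_n) (v : R) :
  (0 < n)%N -> fin_cover E v -> (lebesgue_rV E <= v%:E)%E.
Proof.
move=> n0 [s [h1 h2 h3]].
pose l k := (nth (0, 0) s k).1; pose u k := (nth (0, 0) s k).2.
have lu k i : l k ord0 i <= u k ord0 i.
  rewrite /l /u; have [ks|sk] := ltnP k (size s); last by rewrite nth_default.
  by apply: h1; rewrite mem_nth.
have vol0 k : (0 <= (box_volume (l k) (u k))%:E)%E.
  by rewrite lee_fin prodr_ge0 // => i _; rewrite subr_ge0.
apply: (@le_trans _ _ (\sum_(p <- s) box_volume p.1 p.2)%:E); last first.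
  by rewrite lee_fin.
apply: ereal_inf_lbound; exists l, u; split=> //.
  move=> x /h2[p ps px]; exists (index p s) => //.
  by rewrite /l /u nth_index.
rewrite (@nneseries_split _ _ 0 (size s)); last by move=> k _; exact: vol0.
rewrite add0n [X in (_ + X)%E]eseries0 ?adde0.
  by rewrite (big_nth (0, 0)) sumEFin.
move=> k sk _; rewrite /l /u nth_default // /box_volume /=.
case: n n0 {E h1 h2 h3 l u lu vol0} s sk => // n _ s _.
by rewrite big_ord_recl /= subrr mul0r.
Qed.

(** * Euclidean norm *)

Section euclidean.
Context {R : realType} {n : nat}.
Implicit Types x y z : 'rV[R]_n.

Definition dot x y : R := \sum_i x ord0 i * y ord0 i.

Lemma dotC x y : dot x y = dot y x.
Proof. by apply: eq_bigr => i _; rewrite mulrC. Qed.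

Lemma dotDl x y z : dot (x + y) z = dot x z + dot y z.
Proof. by rewrite -big_split; apply: eq_bigr => i _; rewrite mxE mulrDl. Qed.

Lemma dotNl x y : dot (- x) y = - dot x y.
Proof. by rewrite -sumrN; apply: eq_bigr => i _; rewrite mxE mulNr. Qed.

Lemma dotZl (a : R) x y : dot (a *: x) y = a * dot x y.
Proof. by rewrite mulr_sumr; apply: eq_bigr => i _; rewrite mxE mulrA. Qed.

Lemma dotDr x y z : dot z (x + y) = dot z x + dot z y.
Proof. by rewrite dotC dotDl !(dotC z). Qed.

Lemma dotNr x y : dot x (- y) = - dot x y.
Proof. by rewrite dotC dotNl dotC. Qed.

Lemma dotZr (a : R) x y : dot x (a *: y) = a * dot x y.
Proof. by rewrite dotC dotZl dotC. Qed.

Definition dotE := (dotDl, dotDr, dotNl, dotNr, dotZl, dotZr).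

Lemma enorm_ge0 x : 0 <= enorm x.
Proof. exact: sqrtr_ge0. Qed.

Lemma enorm_sqr x : enorm x ^+ 2 = dot x x.
Proof. by rewrite sqr_sqrtr //; apply: sumr_ge0 => i _; exact: sqr_ge0. Qed.

Lemma enorm_le x (c : R) : 0 <= c -> dot x x <= c ^+ 2 -> enorm x <= c.
Proof. by move=> c0; rewrite -enorm_sqr ler_sqr ?nnegrE ?enorm_ge0. Qed.

Lemma enorm0_dot x y : enorm x = 0 -> dot x y = 0.
Proof.
move=> x0; have := enorm_sqr x; rewrite x0 expr0n /= => /esym/eqP.
rewrite psumr_eq0 => [/allP h|i _]; last exact: sqr_ge0.
apply: big1 => i _; have /eqP := h i (mem_index_enum _).
by move=> /eqP; rewrite mulf_eq0 orbb => /eqP ->; rewrite mul0r.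
Qed.

Lemma enormN x : enorm (- x) = enorm x.
Proof.
by rewrite /enorm; congr Num.sqrt; apply: eq_bigr => i _; rewrite mxE sqrrN.
Qed.

(** Cauchy-Schwarz, by expanding the square of [enorm y *: x - enorm x *: y]; the zero vectors are
    set apart so that the product of norms can be cancelled. *)
Lemma dot_le x y : dot x y <= enorm x * enorm y.
Proof.
have [x0|x0] := eqVneq (enorm x) 0; first by rewrite (enorm0_dot _ x0) x0 mul0r.
have [y0|y0] := eqVneq (enorm y) 0.
  by rewrite dotC (enorm0_dot _ y0) y0 mulr0.
have xy0 : 0 < enorm x * enorm y.
  by rewrite mulr_gt0 // lt0r ?x0 ?y0 enorm_ge0.
rewrite -(ler_pM2l xy0).
have : 0 <= dot (enorm y *: x - enorm x *: y) (enorm y *: x - enorm x *: y).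
  by rewrite -enorm_sqr sqr_ge0.
rewrite !dotE (dotC y x) -!enorm_sqr; nra.
Qed.

Lemma dot_abs_le x y : `|dot x y| <= enorm x * enorm y.
Proof.
by rewrite ler_norml dot_le andbT lerNl -dotNl -(enormN x) dot_le.
Qed.

Lemma enorm_sub x y : enorm (x - y) = enorm (y - x).
Proof. by rewrite -enormN opprB. Qed.

Lemma enormZ (a : R) x : enorm (a *: x) = `|a| * enorm x.
Proof.
apply/eqP; rewrite -(eqrXn2 (n := 2)) ?mulr_ge0 ?enorm_ge0 //.
by rewrite exprMn !enorm_sqr !dotE real_normK ?num_real // mulrA expr2.
Qed.

Lemma enormD x y : enorm (x + y) <= enorm x + enorm y.
Proof.
apply: enorm_le; first by rewrite addr_ge0 ?enorm_ge0.
rewrite !dotE (dotC y x) -!enorm_sqr; have := dot_le x y; nra.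
Qed.

Lemma enorm_tri x y z : enorm (x - z) <= enorm (x - y) + enorm (y - z).
Proof. by rewrite (le_trans _ (enormD _ _)) // subrKA. Qed.

Lemma enorm_dist x y : `|enorm x - enorm y| <= enorm (x - y).
Proof.
have := enormD (x - y) y; have := enormD (y - x) x.
by rewrite !subrK (enorm_sub y x) ler_norml; lra.
Qed.

Lemma coord_le_enorm x i : `|x ord0 i| <= enorm x.
Proof.
rewrite -(ler_pXn2r (n := 2)) ?nnegrE ?enorm_ge0 // enorm_sqr.
rewrite real_normK ?num_real // /dot (bigD1 i) //= expr2 lerDl.
by apply: sumr_ge0 => j _; exact: sqr_ge0.
Qed.

Lemma enorm_le_sum x : enorm x <= \sum_i `|x ord0 i|.
Proof.
have s0 (P : pred 'I_n) : 0 <= \sum_(i | P i) `|x ord0 i| by apply: sumr_ge0.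
apply: enorm_le => //; rewrite /dot expr2 mulr_suml.
apply: ler_sum => i _; rewrite (le_trans (ler_norm _)) // normrM ler_wpM2l //.
by rewrite (bigD1 i) //= lerDl.
Qed.

Lemma enorm_le_coord x (c : R) :
  (forall i, `|x ord0 i| <= c) -> enorm x <= n%:R * c.
Proof.
move=> h; apply: le_trans (enorm_le_sum x) _.
apply: le_trans (ler_sum _ (fun i _ => h i)) _.
by rewrite sumr_const card_ord mulr_natl.
Qed.

(** The largest coordinate works; it later selects the direction in which a sublevel set is thin. *)
Lemma enorm_coord_ex x : (0 < n)%N -> exists i, enorm x <= n%:R * `|x ord0 i|.
Proof.
move=> n0; pose i0 := Ordinal n0.
case: (@Order.TotalTheory.arg_maxP _ _ _ i0 xpredT (fun i => `|x ord0 i|)) => // i _ h.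
by exists i; apply: enorm_le_coord => j; exact: h.
Qed.

End euclidean.

Lemma enorm_lsubmx {R : realType} {n k : nat} (p : 'rV[R]_(n + k)) :
  enorm (lsubmx p) <= enorm p.
Proof.
apply: ler_wsqrtr; rewrite big_split_ord /=.
under eq_bigr do rewrite mxE.
by rewrite lerDl; apply: sumr_ge0 => i _; exact: sqr_ge0.
Qed.

(** * Taylor remainders in one variable *)

Section one_variable.
Context {R : realType}.
Implicit Types (f h k : R -> R) (s t c : R).

(** Derivatives are two-sided and taken on the whole line, so the profiles on [[0, b]] are extended
    before these results are applied. *)
Definition has_derivs f f1 f2 : Prop :=
  (forall t : R, is_derive t 1 f (f1 t)) /\
  (forall t : R, is_derive t 1 f1 (f2 t)).

Lemma derive_continuous k k1 (D : set R) : (forall t : R, is_derive t 1 k (k1 t)) ->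
  {within D, continuous k}.
Proof.
move=> dk; apply: continuous_subspaceT => x.
by apply: differentiable_continuous; apply/derivable1_diffP; case: (dk x).
Qed.

Lemma derive_mvt k k1 s t : (forall u : R, is_derive u 1 k (k1 u)) -> s < t ->
  exists2 c, s < c < t & k t - k s = k1 c * (t - s).
Proof.
move=> dk st.
have [c] := @MVT _ k k1 s t st (fun x _ => dk x) (@derive_continuous k k1 _ dk).
by rewrite in_itv /=; exists c.
Qed.

Lemma increment_le k k1 c : (forall t : R, is_derive t 1 k (k1 t)) ->
  (forall t, 0 <= t <= 1 -> k1 t <= c) -> k 1 - k 0 <= c.
Proof.
move=> dk h; have [x x01 ->] := derive_mvt dk (@ltr01 R).
by rewrite subr0 mulr1 h //; lra.
Qed.

(** Subtract the comparison parabola, then use the mean value theorem once for the difference and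
    once for [k1]; no integral remainder is involved. *)
Lemma taylor2_le k k1 k2 c : has_derivs k k1 k2 ->
  (forall t, 0 <= t <= 1 -> k2 t <= c) -> k 1 - k 0 - k1 0 <= c / 2.
Proof.
move=> [dk dk1] h.
pose H t := k t - k1 0 * t - c / 2 * (t * t).
pose H1 t := k1 t - k1 0 - c * t.
have dH (t : R) : is_derive t 1 H (H1 t).
  rewrite /H /H1; apply: is_derive_eq.
  by rewrite /GRing.scale /=; field.
have [x x01] := derive_mvt dH (@ltr01 R).
have [|y y01 e1] := @derive_mvt k1 k2 0 x dk1; first by lra.
rewrite /H /H1 => e.
have : k2 y <= c by apply: h; lra.
move: e e1; nra.
Qed.

(** For [f1] with derivative [f2] and [f1 0 = 0], this plays the role of the mean of [f2 (t * u)]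
    over [u] in [[0, 1]]. *)
Definition mean_slope (f1 f2 : R -> R) t : R :=
  if t == 0 then f2 0 else f1 t / t.

(** The Taylor remainder divided by the squared increment, that is, the integral of
    [f2 (t + u * (s - t))] against the weight [1 - u] on [[0, 1]]; the weight has mass 1/2, which
    explains the diagonal value. *)
Definition bregman_quot (f f1 f2 : R -> R) s t : R :=
  if s == t then f2 t / 2 else (f s - f t - f1 t * (s - t)) / (s - t) ^+ 2.

Lemma mean_slopeE (f1 f2 : R -> R) t : f1 0 = 0 -> mean_slope f1 f2 t * t = f1 t.
Proof.
by move=> f10; rewrite /mean_slope; case: eqVneq => [->|t0]; rewrite ?mulr0 ?divfK.
Qed.

Lemma bregman_quotE f f1 f2 s t :
  bregman_quot f f1 f2 s t * (s - t) ^+ 2 = f s - f t - f1 t * (s - t).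
Proof.
rewrite /bregman_quot; case: eqVneq => [->|st].
  by rewrite !subrr expr2 !mulr0 subrr.
by rewrite divfK // expf_neq0 // subr_eq0.
Qed.

(** A primitive of [f2 (t * u)] in [u] replaces the integral; it is linear in the degenerate case
    [t = 0]. *)
Lemma mean_slope_rep f f1 f2 t : has_derivs f f1 f2 -> f1 0 = 0 ->
  exists2 k, (forall u : R, is_derive u 1 k (f2 (t * u))) &
             mean_slope f1 f2 t = k 1 - k 0.
Proof.
move=> [df df1] f10; rewrite /mean_slope; case: eqVneq => [->|t0].
  exists (fun u => f2 0 * u) => [u|]; last by rewrite mulr1 mulr0 subr0.
  by apply: is_derive_eq; rewrite /GRing.scale /= mul0r mulr1.
exists (fun u => t^-1 * f1 (t * u)) => [u|]; last first.
  by rewrite mulr1 mulr0 f10 mulr0 subr0 mulrC.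
have d1 : is_derive u 1 (fun u => t * u) t.
  by apply: is_derive_eq; rewrite /GRing.scale /= mulr1.
have d2 := is_derive1_comp (df1 (t * u)) d1.
apply: is_derive_eq; rewrite /GRing.scale /=; field.
by rewrite t0.
Qed.

Lemma bregman_quot_rep f f1 f2 s t : has_derivs f f1 f2 ->
  exists k k1, has_derivs k k1 (fun u => f2 (t + u * (s - t))) /\
             bregman_quot f f1 f2 s t = k 1 - k 0 - k1 0.
Proof.
move=> [df df1]; rewrite /bregman_quot; case: eqVneq => [->|st].
  exists (fun u => f2 t / 2 * (u * u)), (fun u => f2 t * u); split; last by ring.
  split=> u; apply: is_derive_eq; rewrite /GRing.scale /=; first by field.
  by rewrite subrr !mulr0 addr0 mulr1.
have st0 : s - t != 0 by rewrite subr_eq0.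
have d1 (u : R) : is_derive u 1 (fun u => t + u * (s - t)) (s - t).
  by apply: is_derive_eq; rewrite /GRing.scale /=; ring.
exists (fun u => (s - t) ^- 2 * f (t + u * (s - t))),
  (fun u => (s - t)^-1 * f1 (t + u * (s - t))); split; last first.
  rewrite !mul1r !mul0r !addr0 addrCA subrr addr0; field.
  exact: st0.
split=> u.
  have d2 := @is_derive1_comp _ f (fun u => t + u * (s - t)) u _ _ (df _) (d1 u).
  by apply: is_derive_eq; rewrite /GRing.scale /=; field.
have d2 := @is_derive1_comp _ f1 (fun u => t + u * (s - t)) u _ _ (df1 _) (d1 u).
by apply: is_derive_eq; rewrite /GRing.scale /=; field.
Qed.

(** The mean value theorem applied to the difference of the two primitives does the work of
    comparing integrands. *)
Lemma mean_slope_le f f1 f2 h h1 h2 t t' c :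
  has_derivs f f1 f2 -> has_derivs h h1 h2 -> f1 0 = 0 -> h1 0 = 0 ->
  (forall u, 0 <= u <= 1 -> f2 (t * u) <= h2 (t' * u) + c) ->
  mean_slope f1 f2 t <= mean_slope h1 h2 t' + c.
Proof.
move=> df dh f0 h0 H.
have [k dk ->] := mean_slope_rep t df f0.
have [l dl ->] := mean_slope_rep t' dh h0.
have dkl (u : R) : is_derive u 1 (fun u => k u - l u)
    (f2 (t * u) - h2 (t' * u)) by apply: is_derive_eq.
have : k 1 - l 1 - (k 0 - l 0) <= c by apply: (increment_le dkl) => u /H; lra.
by lra.
Qed.

Lemma bregman_quot_le f f1 f2 h h1 h2 s t s' t' c :
  has_derivs f f1 f2 -> has_derivs h h1 h2 ->
  (forall u, 0 <= u <= 1 ->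
    f2 (t + u * (s - t)) <= h2 (t' + u * (s' - t')) + c) ->
  bregman_quot f f1 f2 s t <= bregman_quot h h1 h2 s' t' + c / 2.
Proof.
move=> df dh H.
have [k [k1 [dk ->]]] := bregman_quot_rep s t df.
have [l [l1 [dl ->]]] := bregman_quot_rep s' t' dh.
have dkl : has_derivs (fun u => k u - l u) (fun u => k1 u - l1 u)
    (fun u => f2 (t + u * (s - t)) - h2 (t' + u * (s' - t'))).
  move: dk dl => [dk dk1] [dl dl1].
  by split=> u; apply: is_derive_eq.
have : k 1 - l 1 - (k 0 - l 0) - (k1 0 - l1 0) <= c / 2.
  by apply: (taylor2_le dkl) => u /H; lra.
by lra.
Qed.

(** The model profile: both quotients are constant on it, so comparison with it turns bounds on [f2]
    into bounds on divergences. *)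
Lemma quadratic_derivs c : has_derivs (fun t => c / 2 * (t * t)) ( *%R c) (cst c).
Proof.
split=> t; apply: is_derive_eq; rewrite /GRing.scale /=; first by field.
by rewrite mulr1.
Qed.

Lemma mean_slope_quadratic c t : mean_slope ( *%R c) (cst c) t = c.
Proof. by rewrite /mean_slope; case: eqVneq => // t0; rewrite mulfK. Qed.

Lemma bregman_quot_quadratic c s t :
  bregman_quot (fun t => c / 2 * (t * t)) ( *%R c) (cst c) s t = c / 2.
Proof.
rewrite /bregman_quot; case: eqVneq => // st; field.
by rewrite subr_eq0.
Qed.

End one_variable.

(** * Bregman divergences of radial functions *)

Section radial.
Context {R : realType} {n : nat}.
Implicit Types (f h : R -> R) (w z tau : 'rV[R]_n) (c e s t : R).

Definition radial f z : R := f (enorm z).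

(** The usual [f1 |z| / |z|] times [z], written with [mean_slope] so that the origin needs no
    separate treatment. *)
Definition radial_grad (f1 f2 : R -> R) z : 'rV[R]_n :=
  mean_slope f1 f2 (enorm z) *: z.

Definition bregman f f1 f2 w z : R :=
  radial f w - radial f z - dot (radial_grad f1 f2 z) (w - z).

Lemma bregmanE f f1 f2 w z : f1 0 = 0 ->
  bregman f f1 f2 w z =
    mean_slope f1 f2 (enorm z) / 2 * enorm (w - z) ^+ 2 +
    (bregman_quot f f1 f2 (enorm w) (enorm z)
      - mean_slope f1 f2 (enorm z) / 2) * (enorm w - enorm z) ^+ 2.
Proof.
move=> f10; rewrite mulrBl bregman_quotE -(mean_slopeE f2 _ f10).
rewrite /bregman /radial /radial_grad enorm_sqr !dotE (dotC w z) -!enorm_sqr.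
by field.
Qed.

Lemma sqr_enorm_dist w z : (enorm w - enorm z) ^+ 2 <= enorm (w - z) ^+ 2.
Proof.
rewrite -[leLHS]real_normK ?num_real //.
by rewrite ler_sqr ?nnegrE ?enorm_ge0 // enorm_dist.
Qed.

(** By [bregmanE], half the mean slope and the Bregman quotient enter with weights
    [|w - z|^2 - (|w| - |z|)^2] and [(|w| - |z|)^2]. Both are nonnegative and they add up to
    [|w - z|^2], so a comparison of second derivatives passes to the divergences. *)
Lemma bregman_le f f1 f2 h h1 h2 c w z :
  has_derivs f f1 f2 -> has_derivs h h1 h2 -> f1 0 = 0 -> h1 0 = 0 ->
  (forall t, f2 t <= h2 t + c) ->
  bregman f f1 f2 w z <= bregman h h1 h2 w z + c / 2 * enorm (w - z) ^+ 2.
Proof.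
move=> df dh f0 h0 H; rewrite !bregmanE //.
have := @mean_slope_le _ f f1 f2 h h1 h2 (enorm z) (enorm z) c df dh f0 h0
  (fun u _ => H _).
have := @bregman_quot_le _ f f1 f2 h h1 h2 (enorm w) (enorm z) (enorm w)
  (enorm z) c df dh (fun u _ => H _).
have := sqr_enorm_dist w z; have := sqr_ge0 (enorm w - enorm z).
nra.
Qed.

Lemma bregman_quadratic c w z :
  bregman (fun t => c / 2 * (t * t)) ( *%R c) (cst c) w z
  = c / 2 * enorm (w - z) ^+ 2.
Proof.
rewrite bregmanE ?mulr0 // bregman_quot_quadratic mean_slope_quadratic.
by rewrite subrr mul0r addr0.
Qed.

Lemma bregman_upper f f1 f2 c w z : has_derivs f f1 f2 -> f1 0 = 0 ->
  (forall t, f2 t <= c) -> bregman f f1 f2 w z <= c / 2 * enorm (w - z) ^+ 2.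
Proof.
move=> df f0 H.
have := @bregman_le _ _ _ _ _ _ 0 w z df (quadratic_derivs c) f0 (mulr0 c).
rewrite bregman_quadratic !mul0r addr0; apply => t.
by rewrite addr0 H.
Qed.

Lemma bregman_lower f f1 f2 c w z : has_derivs f f1 f2 -> f1 0 = 0 ->
  (forall t, c <= f2 t) -> c / 2 * enorm (w - z) ^+ 2 <= bregman f f1 f2 w z.
Proof.
move=> df f0 H.
have := @bregman_le _ _ _ _ _ _ 0 w z (quadratic_derivs c) df (mulr0 c) f0.
rewrite bregman_quadratic !mul0r addr0; apply => t.
by rewrite addr0 H.
Qed.

Lemma bregman_sym f f1 f2 w z :
  dot (radial_grad f1 f2 w - radial_grad f1 f2 z) (w - z)
  = bregman f f1 f2 w z + bregman f f1 f2 z w.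
Proof. by rewrite /bregman /radial_grad !dotE; ring. Qed.

(** Adding the divergences in both orders gives strong monotonicity of the gradient (of its opposite
    in the concave case); Cauchy-Schwarz then removes one factor [|w - z|]. *)
Lemma radial_grad_monotone f f1 f2 c w z : has_derivs f f1 f2 -> f1 0 = 0 ->
  (forall t, c <= f2 t) \/ (forall t, f2 t <= - c) ->
  c * enorm (w - z) <= enorm (radial_grad f1 f2 w - radial_grad f1 f2 z).
Proof.
move=> df f0 H; have [wz|wz] := eqVneq (enorm (w - z)) 0.
  by rewrite wz mulr0 enorm_ge0.
have wz0 : 0 < enorm (w - z) by rewrite lt0r wz enorm_ge0.
rewrite -(ler_pM2r wz0).
apply: le_trans (dot_abs_le _ _); rewrite (bregman_sym f).
have e : enorm (z - w) = enorm (w - z) by rewrite enorm_sub.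
case: H => H.
  have := bregman_lower w z df f0 H; have := bregman_lower z w df f0 H.
  rewrite e ler_normr => ? ?; apply/orP; left; nra.
have := bregman_upper w z df f0 H; have := bregman_upper z w df f0 H.
rewrite e ler_normr => ? ?; apply/orP; right; nra.
Qed.

Lemma radial_grad_close f f1 f2 h h1 h2 c z :
  has_derivs f f1 f2 -> has_derivs h h1 h2 -> f1 0 = 0 -> h1 0 = 0 ->
  (forall t, `|h2 t - f2 t| <= c) ->
  enorm (radial_grad h1 h2 z - radial_grad f1 f2 z) <= c * enorm z.
Proof.
move=> df dh f0 h0 H; rewrite /radial_grad -scalerBl enormZ.
rewrite ler_wpM2r ?enorm_ge0 // ler_norml.
have := @mean_slope_le _ f f1 f2 h h1 h2 (enorm z) (enorm z) c df dh f0 h0.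
have := @mean_slope_le _ h h1 h2 f f1 f2 (enorm z) (enorm z) c dh df h0 f0.
have H' t : h2 t <= f2 t + c /\ f2 t <= h2 t + c.
  by have := H t; rewrite ler_norml; lra.
by move=> /(_ (fun u _ => (H' _).1)) + /(_ (fun u _ => (H' _).2)); lra.
Qed.

Lemma radial_grad_bound f f1 f2 c z : has_derivs f f1 f2 -> f1 0 = 0 ->
  (forall t, `|f2 t| <= c) -> enorm (radial_grad f1 f2 z) <= c * enorm z.
Proof.
move=> df f0 H.
have := @radial_grad_close _ _ _ f f1 f2 c z (quadratic_derivs 0) df
  (mulr0 0) f0.
rewrite [radial_grad ( *%R 0) _ z]/radial_grad mean_slope_quadratic scale0r subr0.
by apply => t; rewrite subr0.
Qed.

Lemma bregman_abs f f1 f2 c w z : has_derivs f f1 f2 -> f1 0 = 0 ->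
  (forall t, `|f2 t| <= c) ->
  `|bregman f f1 f2 w z| <= c / 2 * enorm (w - z) ^+ 2.
Proof.
move=> df f0 H.
have H' t : - c <= f2 t /\ f2 t <= c by have := H t; rewrite ler_norml; lra.
have := bregman_lower w z df f0 (fun t => (H' t).1).
have := bregman_upper w z df f0 (fun t => (H' t).2).
by rewrite ler_norml; lra.
Qed.

Lemma radial_lipschitz f f1 f2 c w z : has_derivs f f1 f2 -> f1 0 = 0 ->
  (forall t, `|f2 t| <= c) ->
  `|radial f w - radial f z|
    <= c * (enorm z + enorm (w - z) / 2) * enorm (w - z).
Proof.
move=> df f0 H; have := bregman_abs w z df f0 H.
have := radial_grad_bound z df f0 H.
have := dot_abs_le (radial_grad f1 f2 z) (w - z).
rewrite /bregman !ler_norml; have := enorm_ge0 (w - z).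
have := enorm_ge0 z; nra.
Qed.

Lemma mean_slope_lipschitz f f1 f2 c s t : has_derivs f f1 f2 -> f1 0 = 0 ->
  (forall s t, `|f2 s - f2 t| <= c * `|s - t|) ->
  `|mean_slope f1 f2 s - mean_slope f1 f2 t| <= c * `|s - t|.
Proof.
move=> df f0 H.
wlog suff main : s t / mean_slope f1 f2 s <= mean_slope f1 f2 t + c * `|s - t|.
  by have := main s t; have := main t s; rewrite (distrC t s) ler_norml; lra.
apply: (@mean_slope_le _ f f1 f2 f f1 f2) => // u u01.
have := H (s * u) (t * u); rewrite -mulrBl normrM [`|u|]ger0_norm; last lra.
rewrite ler_norml => /andP[_]; have := le_trans (normr_ge0 _) (H s t).
nra.
Qed.

Lemma bregman_quot_lipschitz f f1 f2 c e s t s' t' : has_derivs f f1 f2 ->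
  0 <= c -> (forall s t, `|f2 s - f2 t| <= c * `|s - t|) ->
  `|s - s'| <= e -> `|t - t'| <= e ->
  `|bregman_quot f f1 f2 s t - bregman_quot f f1 f2 s' t'| <= c * e / 2.
Proof.
move=> df c0 H.
wlog suff main : s t s' t' / `|s - s'| <= e -> `|t - t'| <= e ->
    bregman_quot f f1 f2 s t <= bregman_quot f f1 f2 s' t' + c * e / 2.
  move=> hs ht; have := main s t s' t' hs ht.
  by have := main s' t' s t; rewrite (distrC s') (distrC t') => /(_ hs ht); rewrite ler_norml; lra.
move=> hs ht; apply: bregman_quot_le => // u u01.
have := H (t + u * (s - t)) (t' + u * (s' - t')); rewrite ler_norml => /andP[_].
suff : `|t + u * (s - t) - (t' + u * (s' - t'))| <= e by nra.
by move: hs ht; rewrite !ler_norml; nra.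
Qed.

(** Both terms equal [f2 0 / 2] at the origin, and each is Lipschitz. The factor [s + t] is what
    offsets the singular second difference of the norm. *)
Lemma bregman_quot_mean_slope f f1 f2 c s t : has_derivs f f1 f2 -> f1 0 = 0 ->
  0 <= c -> (forall s t, `|f2 s - f2 t| <= c * `|s - t|) -> 0 <= s -> 0 <= t ->
  `|bregman_quot f f1 f2 s t - mean_slope f1 f2 t / 2| <= c * (s + t).
Proof.
move=> df f0 c0 H s0 t0.
have := @mean_slope_lipschitz f f1 f2 c t 0 df f0 H.
have := @bregman_quot_lipschitz f f1 f2 c (s + t) s t 0 0 df c0 H.
rewrite /bregman_quot [0 == 0]eqxx /mean_slope [0 == 0]eqxx !subr0.
rewrite (ger0_norm s0) (ger0_norm t0).
move=> /(_ ltac:(lra) ltac:(lra)).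
have := mulr_ge0 c0 s0; have := mulr_ge0 c0 t0.
by rewrite !ler_norml; lra.
Qed.

(* The second difference of the Euclidean norm degenerates like 1/|x| at the
   origin; the factor enorm w + enorm z compensates for that. *)
Lemma enorm_second_difference w z tau :
  (enorm w + enorm z) *
    `|(enorm w - enorm z) - (enorm (w - tau) - enorm (z - tau))|
  <= 4 * enorm tau * enorm (w - z).
Proof.
have sz : 0 <= enorm w + enorm z by rewrite addr_ge0 ?enorm_ge0.
rewrite -{1}(ger0_norm sz) -normrM.
(* The second difference of the squared norm is linear in [tau]; dividing out the sums of norms
   leaves a correction controlled by [|tau|]. *)
have e1 : enorm w ^+ 2 - enorm z ^+ 2 - (enorm (w - tau) ^+ 2 - enorm (z - tau) ^+ 2)
    = 2 * dot (w - z) tau.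
  by rewrite !enorm_sqr !dotE (dotC tau w) (dotC tau z); ring.
have := dot_abs_le (w - z) tau.
have := enorm_dist w (w - tau); have := enorm_dist z (z - tau).
have := enorm_dist (w - tau) (z - tau).
have sub3 (x : 'rV[R]_n) : x - (x - tau) = tau by rewrite opprB addrC subrK.
rewrite !sub3 opprB addrA subrK.
set a := enorm w in sz e1 *; set b := enorm z in sz e1 *.
set a' := enorm (w - tau) in e1 *; set b' := enorm (z - tau) in e1 *.
move=> h1 h2 h3 h4.
have -> : (a + b) * (a - b - (a' - b')) =
    2 * dot (w - z) tau - ((a - a') + (b - b')) * (a' - b').
  by rewrite -e1; ring.
apply: le_trans (ler_normB _ _) _; rewrite !normrM (ger0_norm (ler0n _ 2)).
have h5 : `|a - a' + (b - b')| <= 2 * enorm tau.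
  by apply: le_trans (ler_normD _ _) _; lra.
have := ler_pM (normr_ge0 _) (normr_ge0 _) h5 h1.
by lra.
Qed.

(** Three errors: the change of the mean slope, the change of the Bregman quotient, and the change
    of [(|w| - |z|)^2], which [enorm_second_difference] bounds after pairing with
    [bregman_quot_mean_slope]. Their constants 1/2, 1 and 8 add up to less than 10. *)
Lemma bregman_shift f f1 f2 c w z tau : has_derivs f f1 f2 -> f1 0 = 0 ->
  0 <= c -> (forall s t, `|f2 s - f2 t| <= c * `|s - t|) ->
  `|bregman f f1 f2 w z - bregman f f1 f2 (w - tau) (z - tau)|
    <= 10 * c * enorm tau * enorm (w - z) ^+ 2.
Proof.
move=> df f0 c0 H; rewrite !bregmanE //.
have sub3 (x : 'rV[R]_n) : x - (x - tau) = tau by rewrite opprB addrC subrK.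
have hw := enorm_dist w (w - tau); have hz := enorm_dist z (z - tau).
have := enorm_second_difference w z tau.
have := enorm_dist w z; have := enorm_dist (w - tau) (z - tau).
rewrite !sub3 opprB addrA subrK in hw hz *.
have := bregman_quot_mean_slope df f0 c0 H (enorm_ge0 w) (enorm_ge0 z).
have := bregman_quot_lipschitz df c0 H hw hz.
have := mean_slope_lipschitz (enorm z) (enorm (z - tau)) df f0 H.
have := enorm_ge0 w; have := enorm_ge0 z.
have := enorm_ge0 tau; have := enorm_ge0 (w - z); move: hw hz.
set s := enorm w; set t := enorm z.
set s' := enorm (w - tau); set t' := enorm (z - tau).
set q := bregman_quot _ _ _ _ _; set q' := bregman_quot _ _ _ _ _.
set p := mean_slope _ _ _; set p' := mean_slope _ _ _.
move: (enorm (w - z)) (enorm tau) s t s' t' q q' p p' => V T s t s' t' q q' p p'.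
move=> hw hz V0 T0 t0 s0 hp hq hqp hS' hS h2.
have hp' : `|p - p'| <= c * T by apply: le_trans hp _; rewrite ler_wpM2l.
have -> : p / 2 * V ^+ 2 + (q - p / 2) * (s - t) ^+ 2 -
   (p' / 2 * V ^+ 2 + (q' - p' / 2) * (s' - t') ^+ 2) =
   (p - p') / 2 * V ^+ 2 + ((q - q') - (p - p') / 2) * (s' - t') ^+ 2
   + (q - p / 2) * ((s - t - (s' - t')) * (s - t + (s' - t'))).
  by field.
have b1 : `|(p - p') / 2 * V ^+ 2| <= c * T / 2 * V ^+ 2.
  rewrite normrM (ger0_norm (sqr_ge0 V)) ler_wpM2r ?sqr_ge0 //.
  by rewrite normrM (@ger0_norm _ 2^-1) ?invr_ge0 // ler_wpM2r ?invr_ge0.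
have b2 : `|((q - q') - (p - p') / 2) * (s' - t') ^+ 2| <= c * T * V ^+ 2.
  rewrite normrM; apply: ler_pM => //.
    by move: hq hp'; rewrite !ler_norml; lra.
  by rewrite normrX ler_sqr ?nnegrE.
have b3 : `|(q - p / 2) * ((s - t - (s' - t')) * (s - t + (s' - t')))|
    <= 8 * c * T * V ^+ 2.
  rewrite !normrM mulrA.
  have b31 : `|q - p / 2| * `|s - t - (s' - t')| <= c * (4 * T * V).
    apply: (@le_trans _ _ (c * (s + t) * `|s - t - (s' - t')|)).
      by rewrite ler_wpM2r.
    by rewrite -mulrA ler_wpM2l.
  have b32 : `|s - t + (s' - t')| <= 2 * V.
    by apply: le_trans (ler_normD _ _) _; lra.
  have := ler_pM _ (normr_ge0 _) b31 b32.
  by rewrite mulr_ge0 // => /(_ isT); nra.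
apply: le_trans (ler_normD _ _) _.
apply: le_trans (lerD (ler_normD _ _) (lexx _)) _.
have : 0 <= c * T * V ^+ 2 by rewrite !mulr_ge0 ?sqr_ge0.
by lra.
Qed.

End radial.

(** * Covering a thin set over a graph *)

Section graph_cover.
Context {R : realType} {d : nat}.
Variables (E : set 'rV[R]_(d + 1)) (zeta : 'rV[R]_(d + 1) -> 'rV[R]_d).
Variables (G : 'rV[R]_d -> R) (K delta : R).
Hypothesis delta_gt0 : 0 < delta.
Hypothesis K_ge0 : 0 <= K.
Hypothesis zeta_close : forall p, E p -> enorm (lsubmx p - zeta p) <= delta.
Hypothesis graph_close : forall p, E p ->
  `|p ord0 (rshift d ord0) - G (zeta p)| <= delta.
Hypothesis G_lipschitz : forall p p', E p -> E p' ->
  `|G (zeta p) - G (zeta p')| <= K * enorm (zeta p - zeta p').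

(** Height, in units of [delta], of the part of [E] over a cube of side [delta]: 2 from the distance
    to the graph, and [K] times the spread [d + 2] of the base points. *)
Let c0 := (2 + K * (d%:R + 2)).

Lemma zeta_coord p p' j : E p -> E p' ->
  `|(p ord0 (lshift 1 j) - p' ord0 (lshift 1 j))
    - (zeta p ord0 j - zeta p' ord0 j)| <= 2 * delta.
Proof.
move=> Ep Ep'.
have := le_trans (coord_le_enorm _ j) (zeta_close Ep).
have := le_trans (coord_le_enorm _ j) (zeta_close Ep').
by rewrite !mxE !ler_norml; lra.
Qed.

Lemma last_extent p p' : E p -> E p' ->
  (forall j, `|p ord0 (lshift 1 j) - p' ord0 (lshift 1 j)| <= delta) ->
  `|p ord0 (rshift d ord0) - p' ord0 (rshift d ord0)| <= c0 * delta.
Proof.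
move=> Ep Ep' h.
have hl : enorm (lsubmx p - lsubmx p') <= d%:R * delta.
  by apply: enorm_le_coord => j; have := h j; rewrite !mxE.
have h1 := zeta_close Ep; have h2 := zeta_close Ep'.
have hz : enorm (zeta p - zeta p') <= (d%:R + 2) * delta.
  have := enorm_tri (zeta p) (lsubmx p) (zeta p').
  have := enorm_tri (lsubmx p) (lsubmx p') (zeta p').
  by rewrite (enorm_sub (zeta p) (lsubmx p)); lra.
have h3 := G_lipschitz Ep Ep'.
have h4 : K * enorm (zeta p - zeta p') <= K * ((d%:R + 2) * delta).
  by rewrite ler_wpM2l.
have := graph_close Ep; have := graph_close Ep'.
move: h3; rewrite /c0 !ler_norml; lra.
Qed.

Let c0_ge0 : 0 <= c0.
Proof. by rewrite /c0 addr_ge0 ?mulr_ge0 ?addr_ge0. Qed.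

Lemma fin_cover_column (F : set 'rV[R]_(d + 1)) : F `<=` E ->
  (forall p p', F p -> F p' -> forall j,
    `|p ord0 (lshift 1 j) - p' ord0 (lshift 1 j)| <= delta) ->
  fin_cover F ((2 * delta) ^+ d * (2 * c0 * delta)).
Proof.
move=> FE hF.
pose e (k : 'I_(d + 1)) := if (k < d)%N then delta else c0 * delta.
have -> : (2 * delta) ^+ d * (2 * c0 * delta) = \prod_k (2 * e k).
  rewrite big_split_ord /= big_ord1; congr (_ * _).
    rewrite (eq_bigr (fun=> 2 * delta)) => [|j _]; last by rewrite /e /= ltn_ord.
    by rewrite prodr_const card_ord.
  by rewrite /e /= addn0 ltnn mulrA.
apply: fin_cover_extent => [k|p p' Fp Fp' k].
  by rewrite /e; case: ifP => _; rewrite ?mulr_ge0 // ltW.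
have [j ->|j ->] := split_ordP k; rewrite /e /=.
  by rewrite ltn_ord; exact: hF.
rewrite (ord1 j) addn0 ltnn; apply: last_extent; [exact: FE|exact: FE|].
exact: hF.
Qed.

Lemma fin_cover_ball (r : R) : 0 <= r ->
  (forall p p', E p -> E p' -> enorm (zeta p - zeta p') <= r) ->
  fin_cover E ((4 * r + 10 * delta) ^+ d * (2 * c0 * delta)).
Proof.
move=> r0 hr.
pose J := [seq lshift 1 j | j <- enum 'I_d].
have sJ : size J = d by rewrite size_map size_enum_ord.
(* Base points spread by [r] let the points of [E] spread by [r + 2 * delta]; the number of slabs
   times the box width [2 * delta] is [4 * r + 10 * delta]. *)
have -> : (4 * r + 10 * delta) ^+ d * (2 * c0 * delta) =
    (2 * (r + 2 * delta) / delta + 1) ^+ size J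
    * ((2 * delta) ^+ d * (2 * c0 * delta)).
  rewrite sJ [RHS]mulrA -exprMn; congr (_ ^+ _ * _); field.
  by rewrite gt_eqF.
apply: fin_cover_slices => //; first by rewrite addr_ge0 ?mulr_ge0 // ltW.
- by rewrite mulr_ge0 ?exprn_ge0 ?mulr_ge0 // ltW.
- move=> p p' Ep Ep' i /mapP[j _ ->].
  have := zeta_coord j Ep Ep'.
  have := le_trans (coord_le_enorm _ j) (hr _ _ Ep Ep').
  by rewrite !mxE !ler_norml; lra.
move=> F FE hF; apply: fin_cover_column => // p p' Fp Fp' j.
by apply: hF => //; apply/mapP; exists j => //; rewrite mem_enum.
Qed.

(** Slicing the coordinates other than [i] to width [delta] leaves the base points within
    [3 * delta] of each other there. Only then is coordinate [i] confined to extent [x]. *)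
Lemma fin_cover_direction (r x : R) (i : 'I_d) : 0 <= r -> 0 <= x ->
  (forall p p', E p -> E p' -> enorm (zeta p - zeta p') <= r) ->
  (forall p p', E p -> E p' ->
    (forall j, j != i -> `|zeta p ord0 j - zeta p' ord0 j| <= 3 * delta) ->
    `|zeta p ord0 i - zeta p' ord0 i| <= x) ->
  fin_cover E ((4 * r + 10 * delta) ^+ d.-1 *
    ((4 * x + 10 * delta) * (2 * c0 * delta))).
Proof.
move=> r0 x0 hr hx.
pose J := [seq lshift 1 j | j <- enum (predC1 i)].
have sJ : size J = d.-1.
  by rewrite size_map -cardE cardC1 card_ord.
have d0 : (0 < d)%N by rewrite (leq_ltn_trans _ (ltn_ord i)).
have -> : (4 * r + 10 * delta) ^+ d.-1 *
    ((4 * x + 10 * delta) * (2 * c0 * delta)) =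
    (2 * (r + 2 * delta) / delta + 1) ^+ size J
    * ((2 * (x + 2 * delta) / delta + 1)
      * ((2 * delta) ^+ d * (2 * c0 * delta))).
  rewrite sJ -{3}(prednK d0) exprS.
  have -> : 4 * r + 10 * delta =
      (2 * (r + 2 * delta) / delta + 1) * (2 * delta).
    by field; rewrite gt_eqF.
  rewrite exprMn; field.
  by rewrite gt_eqF.
have v0 : 0 <= (2 * delta) ^+ d * (2 * c0 * delta).
  by rewrite mulr_ge0 ?exprn_ge0 ?mulr_ge0 // ltW.
have x2 : 0 <= x + 2 * delta by rewrite addr_ge0 ?mulr_ge0 // ltW.
apply: fin_cover_slices => //; first by rewrite addr_ge0 ?mulr_ge0 // ltW.
- by rewrite mulr_ge0 // addr_ge0 // divr_ge0 ?mulr_ge0 // ltW.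
- move=> p p' Ep Ep' k /mapP[j _ ->].
  have := zeta_coord j Ep Ep'.
  have := le_trans (coord_le_enorm _ j) (hr _ _ Ep Ep').
  by rewrite !mxE !ler_norml; lra.
move=> F FE hF; apply: (@fin_cover_slice _ _ _ (lshift 1 i)) => //.
  move=> p p' Fp Fp'; have [Ep Ep'] := (FE _ Fp, FE _ Fp').
  have := zeta_coord i Ep Ep'.
  suff : `|zeta p ord0 i - zeta p' ord0 i| <= x by rewrite !ler_norml; lra.
  apply: hx => // j ji; have := zeta_coord j Ep Ep'.
  have := hF _ _ Fp Fp' (lshift 1 j).
  rewrite map_f ?mem_enum //= => /(_ isT).
  by rewrite !ler_norml; lra.
move=> F' F'F hF'; apply: fin_cover_column => [p /F'F /FE //|p p' Fp Fp' j].
have [->|ji] := eqVneq j i; first exact: hF'.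
apply: hF; [exact: F'F|exact: F'F|].
by rewrite map_f // mem_enum.
Qed.

End graph_cover.

Lemma sum_neq_le {R : realType} {d : nat} (i : 'I_d) (F : 'I_d -> R) (c : R) :
  0 <= c -> (forall j, j != i -> `|F j| <= c) ->
  `|\sum_(j | j != i) F j| <= d%:R * c.
Proof.
move=> c0 h; apply: le_trans (ler_norm_sum _ _ _) _.
apply: le_trans (ler_sum _ h) _.
rewrite sumr_const -[_ *+ _]mulr_natl ler_wpM2r // ler_nat.
by rewrite (leq_trans (max_card _)) // card_ord.
Qed.

(** Moving by [v] along coordinate [i] raises [H] by [rho / d * |v|]; the allowed nonlinear loss
    takes half of this, and the other coordinates contribute only multiples of [delta]. Since [H]
    varies by at most [2 * M1 * delta], [|v|] is bounded. The 5 rounds up 3 + 3/2, using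
    [rho <= M2]. *)
Lemma sublevel_extent {R : realType} {d : nat} (H : 'rV[R]_d -> R)
    (z z' V : 'rV[R]_d) (i : 'I_d) (sg rho M1 M2 delta : R) :
  0 < delta -> 0 < rho -> sg ^+ 2 = 1 ->
  `|H z| <= M1 * delta -> `|H z'| <= M1 * delta -> rho <= M2 ->
  enorm V <= M2 -> rho / d%:R <= sg * V ord0 i ->
  0 <= sg * (z' ord0 i - z ord0 i) ->
  dot V (z' - z) - rho / (2 * d%:R) * enorm (z' - z) <= H z' - H z ->
  (forall j, j != i -> `|z' ord0 j - z ord0 j| <= 3 * delta) ->
  `|z' ord0 i - z ord0 i|
    <= 2 * d%:R / rho * (2 * M1 + 5 * d%:R * M2) * delta.
Proof.
move=> d0 r0 sg1 Hz Hz' rM VM Vi vi lin vj.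
have n0 : (0 < d)%N by rewrite (leq_ltn_trans _ (ltn_ord i)).
have n1 : 1 <= d%:R :> R by rewrite ler1n.
set D : R := d%:R in n1 *; set v := z' ord0 i - z ord0 i in vi *.
have sgv : `|v| = sg * v.
  have /eqP : sg ^+ 2 = 1 by [].
  rewrite -[1](expr1n _ 2) eqf_sqr => /orP[]/eqP sE; move: vi; rewrite sE.
    by rewrite !mul1r => /ger0_norm.
  by rewrite !mulN1r oppr_ge0 => /ler0_norm.
have e1 : dot V (z' - z) =
    V ord0 i * v + \sum_(j | j != i) V ord0 j * (z' - z) ord0 j.
  by rewrite /dot (bigD1 i) //= !mxE.
have M20 : 0 <= M2 by apply: le_trans rM; exact: ltW.
have e2 : `|\sum_(j | j != i) V ord0 j * (z' - z) ord0 j| <= D * (M2 * (3 * delta)).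
  apply: sum_neq_le => [|j ji]; first by rewrite !mulr_ge0 // ltW.
  rewrite normrM !mxE; apply: ler_pM => //; last exact: vj.
  exact: le_trans (coord_le_enorm _ _) VM.
have e3 : enorm (z' - z) <= `|v| + D * (3 * delta).
  apply: le_trans (enorm_le_sum _) _; rewrite (bigD1 i) //= !mxE lerD2l.
  apply: le_trans (ler_norm _) _; apply: sum_neq_le => [|j ji].
    by rewrite mulr_ge0 // ltW.
  by rewrite normr_id !mxE vj.
have D0 : 0 < D by lra.
have rD : 0 < rho / (2 * D) by rewrite divr_gt0 // mulr_gt0.
have e4 : rho / D * `|v| <= V ord0 i * v.
  have -> : V ord0 i * v = sg * V ord0 i * (sg * v).
    by rewrite mulrACA -expr2 sg1 mul1r.
  by rewrite sgv ler_wpM2r.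
have e5 : rho / (2 * D) * enorm (z' - z) <= rho / (2 * D) * `|v| + 3 / 2 * rho * delta.
  apply: le_trans (ler_wpM2l (ltW rD) e3) _; rewrite mulrDr lerD2l.
  rewrite le_eqVlt; apply/orP; left; apply/eqP; field.
  by rewrite gt_eqF.
have e6 : rho / D * `|v| = rho / (2 * D) * `|v| + rho / (2 * D) * `|v|.
  by field; rewrite gt_eqF.
rewrite -(ler_pM2l rD).
have -> : rho / (2 * D) * (2 * D / rho * (2 * M1 + 5 * D * M2) * delta) =
    (2 * M1 + 5 * D * M2) * delta.
  by field; rewrite !gt_eqF.
have e7 : rho * delta <= D * M2 * delta.
  by rewrite ler_wpM2r ?(ltW d0) // (le_trans rM) // ler_peMl.
move: Hz Hz' e2; rewrite !ler_norml; lra.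
Qed.

(** Some coordinate of the gradient has size at least [rho / d]. Its index and sign split [E] into
    [2 * d] pieces, each thin in a fixed direction by [sublevel_extent]. *)
Lemma fin_cover_gradient {R : realType} {d : nat} (E : set 'rV[R]_(d + 1))
    (zeta : 'rV[R]_(d + 1) -> 'rV[R]_d) (G H : 'rV[R]_d -> R)
    (V : 'rV[R]_d -> 'rV[R]_d) (K delta rho r M1 M2 : R) :
  0 < delta -> 0 <= K -> (0 < d)%N ->
  (forall p, E p -> enorm (lsubmx p - zeta p) <= delta) ->
  (forall p, E p -> `|p ord0 (rshift d ord0) - G (zeta p)| <= delta) ->
  (forall p p', E p -> E p' ->
    `|G (zeta p) - G (zeta p')| <= K * enorm (zeta p - zeta p')) ->
  0 <= r -> 0 < rho -> 0 <= M1 -> 0 <= M2 ->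
  (forall p p', E p -> E p' -> enorm (zeta p - zeta p') <= r) ->
  (forall p, E p -> `|H (zeta p)| <= M1 * delta) ->
  (forall p, E p -> rho <= enorm (V (zeta p)) <= M2) ->
  (forall p p', E p -> E p' ->
    dot (V (zeta p)) (zeta p' - zeta p)
      - rho / (2 * d%:R) * enorm (zeta p' - zeta p)
    <= H (zeta p') - H (zeta p)) ->
  let x := 2 * d%:R / rho * (2 * M1 + 5 * d%:R * M2) * delta in
  fin_cover E ((d * 2)%:R * ((4 * r + 10 * delta) ^+ d.-1 *
    ((4 * x + 10 * delta) * (2 * (2 + K * (d%:R + 2)) * delta)))).
Proof.
move=> d0 K0 n0 h1 h2 h3 r0 rho0 M10 M20 hr hH hV hlin x.
pose I : seq ('I_d * bool) := enum {: 'I_d * bool}.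
pose F (k : 'I_d * bool) := [set p | E p /\
  rho / d%:R <= (-1) ^+ k.2 * V (zeta p) ord0 k.1].
have sI : size I = (d * 2)%N.
  by rewrite -cardE card_prod card_ord card_bool.
have x0 : 0 <= x.
  by rewrite /x !mulr_ge0 ?invr_ge0 ?addr_ge0 ?mulr_ge0 // ltW.
rewrite -sI; apply: (@fin_cover_sub _ _ _ [set p | exists2 k, k \in I & F k p]).
  move=> p Ep; have [i hi] := enorm_coord_ex (V (zeta p)) n0.
  have /andP[rV _] := hV _ Ep.
  have ri : rho / d%:R <= `|V (zeta p) ord0 i|.
    by rewrite ler_pdivrMr ?ltr0n // mulrC (le_trans rV).
  exists (i, V (zeta p) ord0 i < 0); first by rewrite mem_enum.
  by split=> //=; rewrite mulr_sign; case: ifP ri => [/ltr0_norm ->//|];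
    move=> /negbT; rewrite -leNgt => /ger0_norm ->.
apply: fin_cover_seq => -[i b] _; apply: (@fin_cover_direction _ _ _ zeta G K) => //.
- by move=> p [/h1].
- by move=> p [/h2].
- by move=> p p' [Ep _] [Ep' _]; exact: h3.
- by move=> p p' [Ep _] [Ep' _]; exact: hr.
move=> p p' [Ep Vp] [Ep' Vp'] hj.
have sg1 : ((-1) ^+ b) ^+ 2 = 1 :> R by rewrite sqrr_sign.
have rM : rho <= M2 by have /andP[? ?] := hV _ Ep; lra.
(* The linear lower bound is used at whichever point comes first in the direction of increase of
   [H]. *)
have [sgn|sgn] := leP 0 ((-1) ^+ b * (zeta p ord0 i - zeta p' ord0 i)).
  have /andP[_ VM] := hV _ Ep'.
  exact: (sublevel_extent d0 rho0 sg1 (hH _ Ep') (hH _ Ep) rM VM Vp' sgn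
    (hlin _ _ Ep' Ep)).
have /andP[_ VM] := hV _ Ep; rewrite distrC.
apply: (sublevel_extent d0 rho0 sg1 (hH _ Ep) (hH _ Ep') rM VM Vp _
    (hlin _ _ Ep Ep')) => [|j ji].
  by rewrite -opprB mulrN oppr_ge0 ltW.
by rewrite distrC hj.
Qed.

(** * Sublevel sets *)

Definition column_const {R : realType} (d : nat) (N : R) : R :=
  2 + 2 * N * (d%:R + 2).

(** The bound of [fin_cover_gradient] for [r = 2] and [M1 = M2 = 6 * N]: 18 is [4 * 2 + 10], as
    [delta < 1], and [theta] is a lower bound for [rho / q]. *)
Definition steep_const {R : realType} (d : nat) (N Q theta : R) : R :=
  (d * 2)%:R * (18 ^+ d.-1 *
    ((8 * d%:R * (12 * N + 30 * d%:R * N) / theta + 10 * Q)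
      * (2 * column_const d N))).

(** One summand for each case of [fin_cover_convex], according to whether some gradient is small.
    [W] collects the coefficients of [convex_radius] and [Q], with 1 added so that [W >= 1]. *)
Definition convex_const {R : realType} (d : nat) (N Q c : R) : R :=
  let W := 24 * N / c + 4 / c ^+ 2 + Q + 1 in
  18 ^+ d * (W ^+ d.-1 * (2 * column_const d N)) +
  (d * 2)%:R * (18 ^+ d.-1 * (W *
    (2 * (8 * d%:R * (12 * N + 30 * d%:R * N) + 60 * N)
      * (2 * column_const d N)))).

Section sublevel_cover.
Context {R : realType} {d : nat}.
Variables (E : set 'rV[R]_(d + 1)) (zeta : 'rV[R]_(d + 1) -> 'rV[R]_d).
Variables (G H : 'rV[R]_d -> R) (V : 'rV[R]_d -> 'rV[R]_d).
Variables (N delta q Q : R).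
Hypothesis d_gt1 : (1 < d)%N.
Hypothesis N_ge1 : 1 <= N.
Hypothesis delta01 : 0 < delta < 1.
Hypothesis zeta_close : forall p, E p -> enorm (lsubmx p - zeta p) <= delta.
Hypothesis graph_close : forall p, E p ->
  `|p ord0 (rshift d ord0) - G (zeta p)| <= delta.
Hypothesis G_lipschitz : forall p p', E p -> E p' ->
  `|G (zeta p) - G (zeta p')| <= 2 * N * enorm (zeta p - zeta p').
Hypothesis zeta_le1 : forall p, E p -> enorm (zeta p) <= 1.

Let c0 := column_const d N.

Let delta_gt0 : 0 < delta. Proof. by case/andP: delta01. Qed.
Let N2_ge0 : 0 <= 2 * N. Proof. by move: N_ge1; lra. Qed.
Let c0_gt0 : 0 < c0.
Proof. by rewrite /c0 /column_const ltr_pwDl // mulr_ge0 ?addr_ge0. Qed.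
Let D_ge1 : 1 <= d%:R :> R. Proof. by rewrite ler1n ltnW. Qed.

Let zeta_diam p p' : E p -> E p' -> enorm (zeta p - zeta p') <= 2.
Proof.
move=> Ep Ep'; have := enormD (zeta p) (- zeta p'); rewrite enormN.
by have := zeta_le1 Ep; have := zeta_le1 Ep'; lra.
Qed.

(** Meant for [q <= delta], where [delta] is comparable to [delta ^+ 2 / (delta + q)]. *)
Lemma fin_cover_trivial : fin_cover E (18 ^+ d * (2 * c0 * delta)).
Proof.
have := fin_cover_ball delta_gt0 N2_ge0 zeta_close graph_close G_lipschitz
  (ler0n R 2) zeta_diam.
apply: fin_cover_le; rewrite -/(column_const d N) ler_wpM2r ?mulr_ge0 //; try exact: ltW.
by rewrite lerXn2r ?nnegrE //; move: delta01; lra.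
Qed.

Hypothesis H_small : forall p, E p -> `|H (zeta p)| <= 6 * N * delta.
Hypothesis V_bound : forall p, E p -> enorm (V (zeta p)) <= 6 * N.
Hypothesis q_gt0 : 0 < q.
Hypothesis q_le : q <= Q.
Hypothesis delta_le : delta <= q.

Lemma fin_cover_steep (theta rho : R) :
  0 < theta -> theta * q <= rho ->
  (forall p, E p -> rho <= enorm (V (zeta p))) ->
  (forall p p', E p -> E p' ->
    dot (V (zeta p)) (zeta p' - zeta p)
      - rho / (2 * d%:R) * enorm (zeta p' - zeta p)
    <= H (zeta p') - H (zeta p)) ->
  fin_cover E (steep_const d N Q theta * (delta ^+ 2 / q)).
Proof.
move=> theta0 hrho hV hlin; have N1 := N_ge1.
have rho0 : 0 < rho by apply: lt_le_trans hrho; rewrite mulr_gt0.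
have hV' p : E p -> rho <= enorm (V (zeta p)) <= 6 * N.
  by move=> Ep; rewrite hV // V_bound.
have N6 : 0 <= 6 * N by lra.
have := fin_cover_gradient delta_gt0 N2_ge0 (ltnW d_gt1) zeta_close graph_close
  G_lipschitz (ler0n R 2) rho0 N6 N6 zeta_diam H_small hV' hlin.
apply: fin_cover_le; rewrite /steep_const -/c0 -/(column_const d N) -/c0 -!mulrA ler_wpM2l ?ler0n //.
have le18 : (4 * 2 + 10 * delta) ^+ d.-1 <= 18 ^+ d.-1.
  by rewrite lerXn2r ?nnegrE //; move: delta01; lra.
have ND0 : 0 <= N * d%:R by rewrite mulr_ge0 //; lra.
apply: ler_pM => //.
- by rewrite exprn_ge0 //; move: delta01; lra.
- rewrite !mulr_ge0 ?addr_ge0 ?mulr_ge0 ?invr_ge0 ?(ltW rho0) ?(ltW delta_gt0) ?(ltW c0_gt0) //; lra.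
have rq : rho^-1 <= (theta * q)^-1 by rewrite lef_pV2 ?posrE ?mulr_gt0.
(* This turns the bare [10 * delta] of the cover into a multiple of [delta / q]. *)
have Qq : 1 <= Q / q by rewrite ler_pdivlMr // mul1r.
set A := 8 * d%:R * (12 * N + 30 * d%:R * N).
have A0 : 0 <= A by rewrite /A !mulr_ge0 // addr_ge0 // ?mulr_ge0 //; lra.
apply: (@le_trans _ _ ((A * rho^-1 + 10) * (2 * c0 * delta ^+ 2))).
  by rewrite le_eqVlt; apply/orP; left; apply/eqP; rewrite /A; ring.
apply: (@le_trans _ _ ((A * (theta * q)^-1 + 10 * (Q / q))
    * (2 * c0 * delta ^+ 2))); last first.
  rewrite le_eqVlt; apply/orP; left; apply/eqP; rewrite /A; field.
  by rewrite !gt_eqF.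
rewrite ler_wpM2r ?mulr_ge0 ?(ltW c0_gt0) ?(ltW delta_gt0) //.
by apply: lerD; [rewrite ler_wpM2l | lra].
Qed.

(* A sublevel set lies in the ball where the quadratic lower bound at a point
   of almost minimal gradient g0 is compatible with |H| <= 6 N delta. *)
Lemma convex_radius (c y g0 : R) : 0 < c -> 0 <= y -> 0 <= g0 ->
  c * q * y ^+ 2 <= 12 * N * delta + g0 * y ->
  y ^+ 2 <= 24 * N / c * (delta / q) + 4 / c ^+ 2 * (g0 / q) ^+ 2.
Proof.
move=> c_gt0 y0 g00 h; have N1 := N_ge1.
have cq0 : 0 < c * q by rewrite mulr_gt0.
have t1 : 0 <= 24 * N / c * (delta / q).
  by rewrite mulr_ge0 ?divr_ge0 ?mulr_ge0 ?(ltW c_gt0) ?(ltW q_gt0) ?(ltW delta_gt0) //; lra.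
have t2 : 0 <= 4 / c ^+ 2 * (g0 / q) ^+ 2.
  by rewrite mulr_ge0 ?sqr_ge0 // divr_ge0 ?sqr_ge0.
(* Either the quadratic term absorbs the linear one, leaving [y ^+ 2] of order [delta / q], or the
   linear term dominates and [y] is of order [g0 / q]. *)
have [small|large] := leP (g0 * y) (c * q * y ^+ 2 / 2).
  suff : y ^+ 2 <= 24 * N / c * (delta / q) by lra.
  have -> : 24 * N / c * (delta / q) = 24 * N * delta / (c * q).
    by field; rewrite !gt_eqF.
  by rewrite ler_pdivlMr //; lra.
have y1 : 0 < y.
  rewrite lt0r y0 andbT; apply: contraTneq large => ->.
  by rewrite expr0n /= !mulr0 mul0r ltxx.
suff : y ^+ 2 <= 4 / c ^+ 2 * (g0 / q) ^+ 2 by lra.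
have -> : 4 / c ^+ 2 * (g0 / q) ^+ 2 = (2 * g0 / (c * q)) ^+ 2.
  by field; rewrite !gt_eqF.
rewrite ler_sqr ?nnegrE //; last by rewrite divr_ge0 ?mulr_ge0 // ltW.
rewrite ler_pdivlMr //.
have : 0 < y * (2 * g0 - c * q * y) by move: large; rewrite expr2; lra.
by rewrite pmulr_rgt0 //; lra.
Qed.

Lemma fin_cover_convex (c : R) : 0 < c ->
  (forall p p', E p -> E p' ->
    c * q * enorm (zeta p' - zeta p) ^+ 2 <=
    H (zeta p') - H (zeta p) - dot (V (zeta p)) (zeta p' - zeta p)) ->
  fin_cover E (convex_const d N Q c * (delta ^+ 2 / q)).
Proof.
move=> c_gt0 hc; have N1 := N_ge1.
set W := 24 * N / c + 4 / c ^+ 2 + Q + 1.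
have dq0 : 0 <= delta / q by rewrite divr_ge0 ?(ltW delta_gt0) ?(ltW q_gt0).
have dq1 : delta / q <= 1 by rewrite ler_pdivrMr // mul1r.
have dQ : delta ^+ 2 <= Q * (delta / q).
  rewrite mulrCA expr2 ler_wpM2l ?(ltW delta_gt0) //.
  by rewrite ler_pdivlMr // (le_trans _ q_le) // ler_piMl ?(ltW q_gt0) //; move: delta01; lra.
have Q0 : 0 < Q by rewrite (lt_le_trans q_gt0).
have w1 : 0 <= 24 * N / c by rewrite divr_ge0 ?mulr_ge0 ?(ltW c_gt0) //; lra.
have w2 : 0 <= 4 / c ^+ 2 by rewrite divr_ge0 ?sqr_ge0.
have W1 : 1 <= W by rewrite /W; lra.
set C1 := 18 ^+ d * (W ^+ d.-1 * (2 * c0)).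
set C2 := (d * 2)%:R * (18 ^+ d.-1 * (W *
  (2 * (8 * d%:R * (12 * N + 30 * d%:R * N) + 60 * N) * (2 * c0)))).
have C1_ge0 : 0 <= C1.
  by rewrite /C1 !mulr_ge0 ?exprn_ge0 ?(ltW c0_gt0) //; lra.
have ND0 : 0 <= d%:R * N by rewrite mulr_ge0 //; lra.
have C6_ge0 : 0 <= 8 * d%:R * (12 * N + 30 * d%:R * N) + 60 * N.
  by rewrite addr_ge0 ?mulr_ge0 ?addr_ge0 ?mulr_ge0 //; lra.
have C2_ge0 : 0 <= C2.
  by rewrite /C2 !mulr_ge0 ?exprn_ge0 ?(ltW c0_gt0) ?ler0n //; lra.
have d2q : 0 <= delta ^+ 2 / q by rewrite divr_ge0 ?sqr_ge0 ?(ltW q_gt0).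
have -> : convex_const d N Q c = C1 + C2 by [].
rewrite mulrDl.
have key p p' : E p -> E p' -> c * q * enorm (zeta p' - zeta p) ^+ 2 <=
    12 * N * delta + enorm (V (zeta p)) * enorm (zeta p' - zeta p).
  move=> Ep Ep'; have := hc _ _ Ep Ep'.
  have := dot_abs_le (V (zeta p)) (zeta p' - zeta p).
  by have := H_small Ep; have := H_small Ep'; rewrite !ler_norml; lra.
have radius p p' : E p -> E p' -> enorm (zeta p' - zeta p) ^+ 2 <=
    24 * N / c * (delta / q) + 4 / c ^+ 2 * (enorm (V (zeta p)) / q) ^+ 2.
  by move=> Ep Ep'; apply: convex_radius => //; [exact: enorm_ge0..|exact: key].
have [[p0 [Ep0 Vp0]]|steep] := pselect (exists p, E p /\ enorm (V (zeta p)) ^+ 2 <= delta * q).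
  apply: (@fin_cover_le _ _ _ (C1 * (delta ^+ 2 / q))).
    by rewrite lerDl mulr_ge0.
  (* [Y] dominates the radius given by [convex_radius] at [p0], whose gradient term is at most
     [delta / q]. *)
  set Y := Num.sqrt (W * (delta / q)).
  have Y0 : 0 <= Y by exact: sqrtr_ge0.
  have Y2 : Y ^+ 2 = W * (delta / q) by rewrite sqr_sqrtr // mulr_ge0 //; lra.
  have dY : delta <= Y.
    rewrite -ler_sqr ?nnegrE ?(ltW delta_gt0) // Y2 (le_trans dQ) // ler_wpM2r //.
    by rewrite /W; lra.
  have YW : Y <= W.
    rewrite -ler_sqr ?nnegrE //; last by lra.
    by rewrite Y2 expr2 ler_wpM2l //; lra.
  have rY p : E p -> enorm (zeta p - zeta p0) <= Y.
    move=> Ep; rewrite -ler_sqr ?nnegrE ?enorm_ge0 // Y2.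
    apply: le_trans (radius _ _ Ep0 Ep) _.
    have : (enorm (V (zeta p0)) / q) ^+ 2 <= delta / q.
      rewrite expr_div_n ler_pdivrMr ?exprn_gt0 // expr2 mulrA divfK ?gt_eqF //.
    move=> hh; have := ler_wpM2l w2 hh; rewrite /W; nra.
  have diam p p' : E p -> E p' -> enorm (zeta p - zeta p') <= 2 * Y.
    move=> Ep Ep'; have := enorm_tri (zeta p) (zeta p0) (zeta p').
    by rewrite (enorm_sub (zeta p0)); have := rY _ Ep; have := rY _ Ep'; lra.
  have Y20 : 0 <= 2 * Y by lra.
  have := fin_cover_ball delta_gt0 N2_ge0 zeta_close graph_close G_lipschitz
    Y20 diam.
  apply: fin_cover_le; rewrite -/(column_const d N) -/c0.
  apply: (@le_trans _ _ (18 ^+ d * (W ^+ d.-1 * (delta / q)) * (2 * c0 * delta))).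
    rewrite ler_wpM2r ?mulr_ge0 ?(ltW c0_gt0) ?(ltW delta_gt0) //.
    apply: (@le_trans _ _ ((18 * Y) ^+ d)).
      by rewrite lerXn2r ?nnegrE //; move: delta_gt0; lra.
    rewrite exprMn ler_wpM2l ?exprn_ge0 //.
    (* Here [d >= 2] enters: two factors [Y] supply [W * (delta / q)], and each of the others is at
       most [W]. *)
    have -> : d = d.-2.+2 by case: (d) d_gt1 => [|[]].
    rewrite /= !exprSr -[Y ^+ _ * Y * Y]mulrA -expr2 Y2 -[leRHS]mulrA ler_wpM2r //.
      by rewrite mulr_ge0 //; lra.
    by rewrite lerXn2r ?nnegrE //; lra.
  by rewrite le_eqVlt; apply/orP; left; apply/eqP; rewrite /C1; ring.
apply: (@fin_cover_le _ _ _ (C2 * (delta ^+ 2 / q))).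
  by rewrite lerDr mulr_ge0.
have [[p1 Ep1]|E0] := pselect (E !=set0); last first.
  by apply: fin_cover0 => //; rewrite mulr_ge0.
have steep' p : E p -> delta * q < enorm (V (zeta p)) ^+ 2.
  by move=> Ep; rewrite ltNge; apply/negP => h; apply: steep; exists p.
have [p0 Ep0 minp0] : exists2 p, E p & forall p', E p' ->
    enorm (V (zeta p)) <= 2 * enorm (V (zeta p')).
  pose S := [set enorm (V (zeta p)) | p in E].
  have S0 : S !=set0 by exists (enorm (V (zeta p1))), p1.
  have lbS : has_lbound S by exists 0 => _ [p _ <-]; exact: enorm_ge0.
  have infS : 0 < inf S.
    apply: (@lt_le_trans _ _ (Num.sqrt (delta * q))).
      by rewrite sqrtr_gt0 mulr_gt0.
    apply: lb_le_inf => // _ [p Ep <-].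
    rewrite -ler_sqr ?nnegrE ?enorm_ge0 ?sqrtr_ge0 // sqr_sqrtr.
      exact/ltW/steep'.
    by rewrite mulr_ge0 ?(ltW delta_gt0) ?(ltW q_gt0).
  (* The infimum need not be attained; being positive, it serves as its own tolerance, which costs a
     factor 2. *)
  have [_ [p Ep <-] hp] := inf_adherent infS (conj S0 lbS).
  exists p => // p' Ep'; have : inf S <= enorm (V (zeta p')).
    by apply: ge_inf => //; exists p'.
  by lra.
set g0 := enorm (V (zeta p0)) in minp0.
have g00 : 0 < g0.
  have := lt_trans _ (steep' _ Ep0); move=> /(_ 0).
  by rewrite mulr_gt0 // exprn_even_gt0 //= => /(_ isT); rewrite lt0r enorm_ge0 andbT.
have dg : delta / q <= (g0 / q) ^+ 2.
  rewrite expr_div_n expr2 invfM mulrA ler_pdivrMr // divfK ?gt_eqF //.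
  by rewrite ler_pdivlMr // ltW // steep'.
have g2 : 0 <= (g0 / q) ^+ 2 by exact: sqr_ge0.
have Wg0 : 0 <= W * (g0 / q).
  by rewrite mulr_ge0 ?divr_ge0 ?(ltW g00) ?(ltW q_gt0) //; lra.
have toW (y : R) : 0 <= y -> y ^+ 2 <= W * (g0 / q) ^+ 2 -> y <= W * (g0 / q).
  move=> y0 yW; rewrite -ler_sqr ?nnegrE // exprMn (le_trans yW) //.
  by rewrite ler_wpM2r // expr2 ler_peMl //; lra.
(* The cap at 1 is compatible with the diameter bound 2, and lets all but one factor of [u ^+ d.-1]
   be dropped. *)
pose u := Num.min 1 (W * (g0 / q)).
have u0 : 0 <= u by rewrite le_min ler01.
have u1 : u <= 1 by rewrite ge_min lexx.
have uW : u <= W * (g0 / q) by rewrite ge_min lexx orbT.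
have du : delta <= u.
  rewrite le_min; apply/andP; split; first by move: delta01; lra.
  apply: toW; first exact: ltW.
  apply: le_trans dQ _; apply: le_trans (ler_wpM2l (ltW Q0) dg) _.
  by rewrite ler_wpM2r // /W; lra.
have rad p : E p -> enorm (zeta p - zeta p0) <= W * (g0 / q).
  move=> Ep; apply: toW; first exact: enorm_ge0.
  apply: le_trans (radius _ _ Ep0 Ep) _; rewrite -/g0.
  have := ler_wpM2l w1 dg; have := mulr_ge0 (ltW Q0) g2; rewrite /W; lra.
have diam p p' : E p -> E p' -> enorm (zeta p - zeta p') <= 2 * u.
  move=> Ep Ep'; have := enorm_tri (zeta p) (zeta p0) (zeta p').
  have := zeta_diam Ep Ep'; rewrite (enorm_sub (zeta p0)) => h1 h2.
  suff : enorm (zeta p - zeta p') / 2 <= u by lra.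
  by rewrite le_min; have := rad _ Ep; have := rad _ Ep'; lra.
have rho0 : 0 < g0 / 2 by rewrite divr_gt0.
have hV p : E p -> g0 / 2 <= enorm (V (zeta p)) <= 6 * N.
  by move=> Ep; rewrite V_bound // andbT; have := minp0 _ Ep; lra.
have N6 : 0 <= 6 * N by lra.
have u20 : 0 <= 2 * u by lra.
have hlin p p' : E p -> E p' -> dot (V (zeta p)) (zeta p' - zeta p)
    - g0 / 2 / (2 * d%:R) * enorm (zeta p' - zeta p)
    <= H (zeta p') - H (zeta p).
  move=> Ep Ep'; have := hc _ _ Ep Ep'.
  have : 0 <= c * q * enorm (zeta p' - zeta p) ^+ 2.
    by rewrite !mulr_ge0 ?sqr_ge0 ?enorm_ge0 ?(ltW c_gt0) ?(ltW q_gt0).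
  have : 0 <= g0 / 2 / (2 * d%:R) * enorm (zeta p' - zeta p).
    by rewrite mulr_ge0 ?enorm_ge0 // divr_ge0 ?(ltW rho0) // mulr_ge0.
  by lra.
have := fin_cover_gradient delta_gt0 N2_ge0 (ltnW d_gt1) zeta_close graph_close
  G_lipschitz u20 rho0 N6 N6 diam H_small hV hlin.
apply: fin_cover_le; rewrite -/(column_const d N) -/c0.
set A := 8 * d%:R * (12 * N + 30 * d%:R * N) in C2 C2_ge0 C6_ge0 *.
have gN : g0 / 2 <= 6 * N by have /andP[] := hV _ Ep0; lra.
have c0_ge0 := ltW c0_gt0; have delta_ge0 := ltW delta_gt0.
(* One factor [u] yields [g0 / q], while the thin direction yields [delta / g0] in [step2]; [g0]
   cancels in the product. *)
have step : (4 * (2 * u) + 10 * delta) ^+ d.-1 <= 18 ^+ d.-1 * (W * (g0 / q)).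
  apply: (@le_trans _ _ ((18 * u) ^+ d.-1)).
    by rewrite lerXn2r ?nnegrE //; lra.
  rewrite exprMn ler_wpM2l ?exprn_ge0 // (le_trans _ uW) //.
  have -> : d.-1 = d.-2.+1 by case: (d) d_gt1 => [|[]].
  by rewrite exprS ler_piMr // exprn_ile1.
have step2 : 4 * (2 * d%:R / (g0 / 2) * (2 * (6 * N) + 5 * d%:R * (6 * N)) * delta)
    + 10 * delta <= 2 * (A + 60 * N) / g0 * delta.
  have -> : 4 * (2 * d%:R / (g0 / 2) * (2 * (6 * N) + 5 * d%:R * (6 * N)) * delta)
      = 2 * A / g0 * delta.
    by rewrite /A; field; rewrite gt_eqF.
  rewrite -mulrDl ler_wpM2r // mulrDr mulrDl lerD2l ler_pdivlMr //.
  by lra.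
apply: (@le_trans _ _ ((d * 2)%:R * ((18 ^+ d.-1 * (W * (g0 / q))) *
    ((2 * (A + 60 * N) / g0 * delta) * (2 * c0 * delta))))).
  rewrite ler_wpM2l ?ler0n //; apply: ler_pM => //.
  - by rewrite exprn_ge0 //; lra.
  - rewrite mulr_ge0 ?mulr_ge0 // addr_ge0 ?mulr_ge0 ?addr_ge0 ?mulr_ge0 ?invr_ge0 ?(ltW rho0) //; lra.
  by rewrite ler_wpM2r // !mulr_ge0.
rewrite le_eqVlt; apply/orP; left; apply/eqP; rewrite /C2; field.
by rewrite !gt_eqF.
Qed.

End sublevel_cover.

(** * Two profiles *)

(** Sum over three regimes: [q <= delta], large translation, small translation. Each factor 2 comes
    from replacing [delta] or [q] by [delta + q] in a denominator, and [2 * N / lam] bounds [q]. *)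
Definition cover_const {R : realType} (d : nat) (N lam eps : R) : R :=
  2 * (18 ^+ d * (2 * column_const d N))
  + 2 * steep_const d N (2 * N / lam) (4 * d%:R * N * eps)
  + 2 * convex_const d N (2 * N / lam) (lam / 4).

Section two_profiles.
Context {R : realType} {d : nat}.
Variables (N m lam eps q delta : R) (f f1 f2 h h1 h2 : R -> R).
Hypothesis d_gt1 : (1 < d)%N.
Hypothesis N_ge1 : 1 <= N.
Hypothesis m_gt0 : 0 < m.
Hypothesis lam_gt0 : 0 < lam.
Hypothesis eps01 : 0 < eps <= 1.
Hypothesis eps_m : 160 * d%:R * N * eps <= m.
Hypothesis eps_lam : 320 * d%:R * N ^+ 2 * eps <= lam * m.
Hypothesis derivs_f : has_derivs f f1 f2.
Hypothesis derivs_h : has_derivs h h1 h2.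
Hypothesis f1_0 : f1 0 = 0.
Hypothesis h1_0 : h1 0 = 0.
Hypothesis f2_bound : forall t, `|f2 t| <= N.
Hypothesis h2_bound : forall t, `|h2 t| <= N.
Hypothesis f2_lipschitz : forall s t, `|f2 s - f2 t| <= N * `|s - t|.
Hypothesis q_ge0 : 0 <= q.
Hypothesis h2_f2_close : forall t, `|h2 t - f2 t| <= N * q.
Hypothesis f2_sign : (forall t, m <= f2 t) \/ (forall t, f2 t <= - m).
Hypothesis h2_f2_sign :
  (forall t, lam * q <= h2 t - f2 t) \/ (forall t, h2 t - f2 t <= - (lam * q)).
Hypothesis delta01 : 0 < delta < 1.

Variables (tau : 'rV[R]_d) (tau_last : R).
Hypothesis tau_le4 : enorm tau <= 4.

Let H (z : 'rV[R]_d) := radial h z - radial f (z - tau) - tau_last.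
Let V (z : 'rV[R]_d) := radial_grad h1 h2 z - radial_grad f1 f2 (z - tau).

Lemma profile_bregman w z : H w - H z - dot (V z) (w - z) =
  bregman h h1 h2 w z - bregman f f1 f2 (w - tau) (z - tau).
Proof.
have e : w - tau - (z - tau) = w - z by rewrite opprB addrA subrK.
by rewrite /bregman e /H /V dotDl dotNl; ring.
Qed.

Let N_ge0 : 0 <= N. Proof. by move: N_ge1; lra. Qed.

(** [c] may have either sign: [N * q] gives an error bound, [- (lam * q)] gives uniform convexity
    when [tau] is small. *)
Lemma profile_bregman_ge c w z : (forall t, f2 t <= h2 t + c) ->
  - (c / 2 + 10 * N * enorm tau) * enorm (w - z) ^+ 2 <=
  H w - H z - dot (V z) (w - z).
Proof.
move=> hc; rewrite profile_bregman.
have := bregman_le w z derivs_f derivs_h f1_0 h1_0 hc.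
have := bregman_shift w z tau derivs_f f1_0 N_ge0 f2_lipschitz.
rewrite ler_norml mulNr mulrDl; lra.
Qed.

Lemma profile_bregman_le c w z : (forall t, h2 t <= f2 t + c) ->
  H w - H z - dot (V z) (w - z) <=
  (c / 2 + 10 * N * enorm tau) * enorm (w - z) ^+ 2.
Proof.
move=> hc; rewrite profile_bregman.
have := bregman_le w z derivs_h derivs_f h1_0 f1_0 hc.
have := bregman_shift w z tau derivs_f f1_0 N_ge0 f2_lipschitz.
rewrite ler_norml mulrDl; lra.
Qed.

(** Insert the gradient of [f] at [z]: translating it by [tau] changes it by at least [m * |tau|],
    and exchanging the profiles costs at most [N * q * eps]. *)
Lemma profile_grad_ge z : enorm z <= eps ->
  m * enorm tau - N * q * eps <= enorm (V z).
Proof.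
move=> ze.
have h3 := radial_grad_monotone z (z - tau) derivs_f f1_0 f2_sign.
have h4 := radial_grad_close z derivs_f derivs_h f1_0 h1_0 h2_f2_close.
have sub3 : z - (z - tau) = tau by rewrite opprB addrC subrK.
rewrite sub3 in h3.
have h5 : N * q * enorm z <= N * q * eps by rewrite ler_wpM2l // mulr_ge0.
have := enorm_tri (radial_grad f1 f2 z) (radial_grad h1 h2 z)
  (radial_grad f1 f2 (z - tau)).
by rewrite (enorm_sub (radial_grad f1 f2 z) (radial_grad h1 h2 z)) -/(V z); lra.
Qed.

Lemma profile_grad_le z : enorm z <= eps -> enorm (V z) <= 6 * N.
Proof.
move=> ze.
have := radial_grad_bound z derivs_h h1_0 h2_bound.
have := radial_grad_bound (z - tau) derivs_f f1_0 f2_bound.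
have := enormD z (- tau); rewrite enormN => h1' h2' h3'.
have := enormD (radial_grad h1 h2 z) (- radial_grad f1 f2 (z - tau)).
rewrite enormN -/(V z) => h4'.
have b1 : N * enorm (z - tau) <= N * 5.
  by rewrite ler_wpM2l //; move: eps01 tau_le4; lra.
have b2 : N * enorm z <= N * 1 by rewrite ler_wpM2l //; move: eps01; lra.
by lra.
Qed.

Lemma profile_gap_le : q <= 2 * N / lam.
Proof.
rewrite ler_pdivlMr //; have := f2_bound 0; have := h2_bound 0.
by case: h2_f2_sign => /(_ 0); rewrite !ler_norml; lra.
Qed.

Variables (E : set 'rV[R]_(d + 1)) (zeta : 'rV[R]_(d + 1) -> 'rV[R]_d).
Hypothesis zeta_close : forall p, E p -> enorm (lsubmx p - zeta p) <= delta.
Hypothesis graph_close : forall p, E p ->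
  `|p ord0 (rshift d ord0) - radial h (zeta p)| <= delta.
Hypothesis zeta_le : forall p, E p -> enorm (zeta p) <= eps.
Hypothesis H_small : forall p, E p ->
  `|radial h (zeta p) - radial f (zeta p - tau) - tau_last| <= 6 * N * delta.

Lemma fin_cover_profiles :
  fin_cover E (cover_const d N lam eps * (delta ^+ 2 / (delta + q))).
Proof.
have N1 := N_ge1; have := eps01 => /andP[e0 e1].
have := delta01 => /andP[d0 d1].
have D1 : 1 <= d%:R :> R by rewrite ler1n ltnW.
have lam4 : 0 < lam / 4 by move: lam_gt0; lra.
have z1 p : E p -> enorm (zeta p) <= 1 by move=> /zeta_le; lra.
have diam p p' : E p -> E p' -> enorm (zeta p - zeta p') <= 2 * eps.
  move=> Ep Ep'; have := enormD (zeta p) (- zeta p'); rewrite enormN.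
  by have := zeta_le Ep; have := zeta_le Ep'; lra.
have lipG p p' : E p -> E p' -> `|radial h (zeta p) - radial h (zeta p')|
    <= 2 * N * enorm (zeta p - zeta p').
  move=> Ep Ep'.
  apply: le_trans (radial_lipschitz _ _ derivs_h h1_0 h2_bound) _.
  rewrite ler_wpM2r ?enorm_ge0 // mulrC ler_wpM2r //.
  by have := diam _ _ Ep Ep'; have := z1 _ Ep'; lra.
have Q0 : 0 < 2 * N / lam by rewrite divr_gt0 ?mulr_gt0 //; lra.
have th0 : 0 < 4 * d%:R * N * eps by rewrite !mulr_gt0 //; lra.
have ND0 : 0 <= d%:R * N by rewrite mulr_ge0 //; lra.
have c00 : 0 < column_const d N.
  by rewrite /column_const ltr_pwDl // !mulr_ge0 ?addr_ge0.
have A0 : 0 <= 8 * d%:R * (12 * N + 30 * d%:R * N).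
  by rewrite mulr_ge0 ?addr_ge0 ?mulr_ge0.
set T1 := 18 ^+ d * (2 * column_const d N).
have T1_ge0 : 0 <= T1 by rewrite mulr_ge0 ?exprn_ge0 ?mulr_ge0 ?(ltW c00).
set T2 := steep_const d N (2 * N / lam) (4 * d%:R * N * eps).
have T2_ge0 : 0 <= T2.
  rewrite mulr_ge0 ?ler0n // mulr_ge0 ?exprn_ge0 // mulr_ge0 //.
    by rewrite addr_ge0 ?divr_ge0 ?(ltW th0) // mulr_ge0 ?(ltW Q0).
  by rewrite mulr_ge0 ?(ltW c00).
set T3 := convex_const d N (2 * N / lam) (lam / 4).
have T3_ge0 : 0 <= T3.
  rewrite /T3 /convex_const; set W := _ + 1.
  have W0 : 0 <= W.
    have w1 : 0 <= 24 * N / (lam / 4) by rewrite divr_ge0 ?(ltW lam4) // mulr_ge0.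
    have w2 : 0 <= 4 / (lam / 4) ^+ 2 by rewrite divr_ge0 ?sqr_ge0.
    by rewrite /W; lra.
  rewrite addr_ge0 // !mulr_ge0 ?exprn_ge0 ?ler0n ?(ltW c00) //.
  by have := A0; lra.
have -> : cover_const d N lam eps = 2 * T1 + 2 * T2 + 2 * T3 by [].
have dq0 : 0 < delta + q by rewrite ltr_wpDr.
have X0 : 0 <= delta ^+ 2 / (delta + q) by rewrite divr_ge0 ?sqr_ge0 ?(ltW dq0).
have [qd|dq] := leP q delta.
  have := fin_cover_trivial N1 delta01 zeta_close graph_close lipG z1.
  apply: fin_cover_le; rewrite mulrA mulrA -[18 ^+ d * 2 * _]mulrA -/T1.
  have : delta <= 2 * (delta ^+ 2 / (delta + q)).
    by rewrite mulrA ler_pdivlMr // expr2; nra.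
  move=> /(ler_wpM2l T1_ge0).
  have := mulr_ge0 T2_ge0 X0; have := mulr_ge0 T3_ge0 X0; lra.
have q0 : 0 < q by exact: lt_trans dq.
have half : delta ^+ 2 / q <= 2 * (delta ^+ 2 / (delta + q)).
  rewrite mulrCA ler_wpM2l ?sqr_ge0 // ler_pdivlMr // mulrC.
  by rewrite ler_pdivrMr //; lra.
have Vle p : E p -> enorm (V (zeta p)) <= 6 * N by move=> Ep; exact/profile_grad_le/zeta_le.
have close t : f2 t <= h2 t + N * q.
  by have := h2_f2_close t; rewrite ler_norml; lra.
(* Above this threshold [N * q * eps] is at most an eighth of [m * |tau|], so [rho = m * |tau| / 2]
   is admissible with [theta = 4 * d * N * eps]. *)
have [steep|flat] := leP (8 * d%:R * N * eps * q) (m * enorm tau).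
  have rho_ge : 4 * d%:R * N * eps * q <= m * enorm tau / 2 by lra.
  have NqE : N * q * eps * 8 <= m * enorm tau.
    apply: le_trans steep.
    rewrite (_ : N * q * eps * 8 = 8 * (N * eps * q)); last by ring.
    rewrite (_ : 8 * d%:R * N * eps * q = d%:R * (8 * (N * eps * q))); last by ring.
    by rewrite ler_peMl // !mulr_ge0 //; lra.
  apply: (@fin_cover_le _ _ _ (T2 * (delta ^+ 2 / q))).
    have := ler_wpM2l T2_ge0 half.
    have := mulr_ge0 T1_ge0 X0; have := mulr_ge0 T3_ge0 X0; lra.
  apply: (@fin_cover_steep _ _ _ _ _ H V _ _ _ _ d_gt1 N1 delta01 zeta_close
    graph_close lipG z1 H_small Vle q0 profile_gap_le _ _ th0 rho_ge).
    move=> p Ep; apply: le_trans (profile_grad_ge (zeta_le Ep)).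
    have : 0 <= N * q * eps by rewrite !mulr_ge0 // ltW.
    by lra.
  move=> p p' Ep Ep'; have := profile_bregman_ge (zeta p') (zeta p) close.
  have := diam _ _ Ep' Ep; have := enorm_ge0 (zeta p' - zeta p).
  set v := enorm (zeta p' - zeta p) => v0 v2.
  (* With [v <= 2 * eps], the threshold handles the [q] term and [eps_m] the [tau] term; each takes
     half of the available room. *)
  suff : (N * q / 2 + 10 * N * enorm tau) * v ^+ 2
      <= m * enorm tau / 2 / (2 * d%:R) * v by rewrite mulNr; lra.
  rewrite expr2 mulrA ler_wpM2r // ler_pdivlMr; last by lra.
  have t0 := enorm_ge0 tau.
  have b1 : (N * q / 2 + 10 * N * enorm tau) * v
      <= (N * q / 2 + 10 * N * enorm tau) * (2 * eps).
    by rewrite ler_wpM2l // addr_ge0 // ?divr_ge0 ?mulr_ge0.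
  have b2 : 160 * d%:R * N * eps * enorm tau <= m * enorm tau by rewrite ler_wpM2r.
  have b3 := ler_wpM2r (ler0n R (2 * d)) b1.
  rewrite natrM in b3; lra.
(* By [eps_lam], the translation error uses at most half of the convexity constant [lam * q / 2]. *)
have flat' : 10 * N * enorm tau <= lam / 4 * q.
  rewrite -(ler_pM2l m_gt0).
  have b1 : 10 * N * (m * enorm tau) <= 10 * N * (8 * d%:R * N * eps * q).
    by rewrite ler_wpM2l ?mulr_ge0 // ltW.
  have b2 : 320 * d%:R * N ^+ 2 * eps * q <= lam * m * q by rewrite ler_wpM2r.
  by rewrite expr2 in b2; lra.
apply: (@fin_cover_le _ _ _ (T3 * (delta ^+ 2 / q))).
  have := ler_wpM2l T3_ge0 half.
  have := mulr_ge0 T1_ge0 X0; have := mulr_ge0 T2_ge0 X0; lra.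
case: h2_f2_sign => sgn.
  apply: (@fin_cover_convex _ _ _ _ _ H V _ _ _ _ d_gt1 N1 delta01 zeta_close
    graph_close lipG z1 H_small Vle q0 profile_gap_le (ltW dq) _ lam4) => p p' Ep Ep'.
  have sgn' t : f2 t <= h2 t + - (lam * q) by have := sgn t; lra.
  apply: le_trans (profile_bregman_ge (zeta p') (zeta p) sgn').
  by rewrite ler_wpM2r ?sqr_ge0 //; lra.
(* For the other sign of [h2 - f2] it is [- H], with gradient [- V], that is uniformly convex. *)
have H_small' p : E p -> `|- H (zeta p)| <= 6 * N * delta.
  by move=> Ep; rewrite normrN H_small.
have Vle' p : E p -> enorm (- V (zeta p)) <= 6 * N.
  by move=> Ep; rewrite enormN Vle.
apply: (@fin_cover_convex _ _ _ _ _ (fun z => - H z) (fun z => - V z) _ _ _ _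
  d_gt1 N1 delta01 zeta_close graph_close lipG z1
  H_small' Vle' q0 profile_gap_le (ltW dq) _ lam4) => p p' Ep Ep'.
have sgn' t : h2 t <= f2 t + - (lam * q) by have := sgn t; lra.
rewrite dotNl.
have := profile_bregman_le (zeta p') (zeta p) sgn'.
set v := enorm _ ^+ 2; have v0 : 0 <= v by exact: sqr_ge0.
suff : lam / 4 * q * v <= - (- (lam * q) / 2 + 10 * N * enorm tau) * v by lra.
by rewrite ler_wpM2r //; lra.
Qed.

End two_profiles.

(** * Neighbourhoods of the surfaces *)

Lemma nbhd_GammaP {R : realType} (n : nat) (g : R -> R -> R) (a eps delta : R)
    (p : 'rV[R]_(n.-1 + 1)) : nbhd (Gamma n g a eps) delta p ->
  exists z : 'rV[R]_n.-1, [/\ enorm z <= eps, enorm (lsubmx p - z) <= delta &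
    `|p ord0 (rshift n.-1 ord0) - g a (enorm z)| <= delta].
Proof.
move=> [_ [y [[z ze <-] yd ->]]]; exists z; split=> //.
  rewrite linearD /= row_mxKl addrAC subrr add0r.
  exact: le_trans (enorm_lsubmx _) (ltW yd).
rewrite mxE row_mxEr mxE addrAC subrr add0r.
exact: le_trans (coord_le_enorm _ _) (ltW yd).
Qed.

Lemma fin_cover_Gamma {R : realType} (n : nat) (g : R -> R -> R)
    (N m lam eps q b a a' delta : R) (f f1 f2 h h1 h2 : R -> R)
    (tau : 'rV[R]_(n.-1 + 1)) :
  (3 <= n)%N -> 1 <= N -> 0 < m -> 0 < lam -> 0 < eps <= b -> b <= 1 ->
  160 * n.-1%:R * N * eps <= m -> 320 * n.-1%:R * N ^+ 2 * eps <= lam * m ->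
  has_derivs f f1 f2 -> has_derivs h h1 h2 -> f1 0 = 0 -> h1 0 = 0 ->
  (forall t, `|f2 t| <= N) -> (forall t, `|h2 t| <= N) ->
  (forall s t, `|f2 s - f2 t| <= N * `|s - t|) ->
  0 <= q -> (forall t, `|h2 t - f2 t| <= N * q) ->
  (forall t, m <= f2 t) \/ (forall t, f2 t <= - m) ->
  (forall t, lam * q <= h2 t - f2 t) \/
    (forall t, h2 t - f2 t <= - (lam * q)) ->
  (forall t, 0 <= t <= b -> f t = g a t) ->
  (forall t, 0 <= t <= b -> h t = g a' t) ->
  0 < delta < 1 ->
  fin_cover (translate (nbhd (Gamma n g a b) delta) tau
     `&` nbhd (Gamma n g a' eps) delta)
    ((`|cover_const n.-1 N lam eps| + 1) * (delta ^+ 2 / (delta + q))).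
Proof.
move=> n3 N1 m0 lam0 eb b1 em el df dh f0 h0 f2N h2N f2L q0 fh sf sfh fg hg d01.
set E := (X in fin_cover X _); set C := cover_const _ _ _ _.
have /andP[d0 d1] := d01; have /andP[e0 leb] := eb.
have X0 : 0 <= delta ^+ 2 / (delta + q) by rewrite divr_ge0 ?sqr_ge0 // addr_ge0 // ltW.
have C1 : C <= `|C| + 1 by have := ler_norm C; lra.
(* The maximum with 0 covers an empty intersection without discussing the sign of [C]. *)
apply: (@fin_cover_le _ _ _ (Num.max 0 (C * (delta ^+ 2 / (delta + q))))).
  rewrite ge_max; apply/andP; split; last by rewrite ler_wpM2r.
  by rewrite mulr_ge0 // addr_ge0.
pose T := lsubmx tau; pose Tn := tau ord0 (rshift n.-1 ord0).
(* Membership in [E] is placed under the existential so that [choice] gives a total [zeta], with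
   default 0 off [E]. *)
have dat p : exists z : 'rV[R]_n.-1, E p ->
    [/\ enorm (lsubmx p - z) <= delta,
      `|p ord0 (rshift n.-1 ord0) - radial h z| <= delta,
      enorm z <= eps,
      `|radial h z - radial f (z - T) - Tn| <= 6 * N * delta & enorm T <= 4].
  have [[[x nx xp]]|nE] := pselect (E p); last by exists 0.
  move=> /nbhd_GammaP[z [ze zp zg]]; have [X [Xe Xx Xg]] := nbhd_GammaP nx.
  have z0 := enorm_ge0 z; have x0 := enorm_ge0 X.
  exists z => _.
  have hz : radial h z = g a' (enorm z) by apply: hg; lra.
  have fX : radial f X = g a (enorm X) by apply: fg; lra.
  have lx : lsubmx p = lsubmx x + T by rewrite -xp linearD.
  have px : p ord0 (rshift n.-1 ord0) = x ord0 (rshift n.-1 ord0) + Tn.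
    by rewrite -xp mxE.
  have v2 : enorm (z - T - X) <= 2 * delta.
    have -> : z - T - X = (lsubmx x - X) - (lsubmx p - z).
      by rewrite lx; apply/rowP => i; rewrite !mxE; ring.
    by have := enormD (lsubmx x - X) (- (lsubmx p - z)); rewrite enormN; lra.
  have T4 : enorm T <= 4.
    have -> : T = (z - X) - (z - T - X) by apply/rowP => i; rewrite !mxE; ring.
    have := enormD (z - X) (- (z - T - X)); have := enormD z (- X).
    by rewrite !enormN; lra.
  split=> //; first by rewrite hz.
  have := radial_lipschitz (z - T) X df f0 f2N; rewrite fX.
  set v := enorm (z - T - X) in v2 *; have v0 : 0 <= v := enorm_ge0 _.
  move=> lip.
  (* The Lipschitz factor is at most [2 * N] over a distance [2 * delta]; two vertical errors
     [delta] then give [6 * N * delta], as [N >= 1]. *)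
  have : `|radial f (z - T) - g a (enorm X)| <= 4 * N * delta.
    apply: le_trans lip _.
    have Xv : N * (enorm X + v / 2) <= N * 2 by rewrite ler_wpM2l //; lra.
    have := ler_pM _ v0 Xv v2; rewrite mulr_ge0 ?addr_ge0 ?divr_ge0 //; last by lra.
    by move=> /(_ isT); lra.
  rewrite px -hz in zg.
  have : delta <= N * delta by rewrite ler_peMl // ltW.
  by move: zg Xg; rewrite !ler_norml; lra.
have [zeta hzeta] := choice dat.
(* The bound [enorm T <= 4] is only available when the neighbourhoods meet. *)
have [[p0 Ep0]|E0] := pselect (E !=set0); last first.
  by apply: fin_cover0 => //; rewrite le_max lexx.
apply: (@fin_cover_le _ _ _ (C * (delta ^+ 2 / (delta + q)))).
  by rewrite le_max lexx orbT.
have [_ _ _ _ T4] := hzeta _ Ep0.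
have n1 : (1 < n.-1)%N by case: (n) n3 => [|[|[]]].
have e01 : 0 < eps <= 1 by lra.
apply: (@fin_cover_profiles _ _ N m lam eps q delta f f1 f2 h h1 h2 n1 N1 m0
  lam0 e01 em el df dh f0 h0 f2N h2N f2L q0 fh sf sfh d01 T Tn T4 _ zeta).
all: by move=> p /hzeta[].
Qed.

(** * Extension of the profiles to the line *)

Section clamp.
Context {R : realType}.
Implicit Types l u s t : R.

Definition clamp l u t : R := if t < l then l else if u < t then u else t.

Lemma clampP l u t : l <= u ->
  [\/ t < l /\ clamp l u t = l, l <= t <= u /\ clamp l u t = t |
      u < t /\ clamp l u t = u].
Proof.
move=> lu; rewrite /clamp; have [tl|lt] := ltP t l; first by apply: Or31.
by have [ut|tu] := ltP u t; [apply: Or33 | apply: Or32].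
Qed.

Lemma clamp_itv l u t : l <= u -> l <= clamp l u t <= u.
Proof. by move=> lu; case: (clampP t lu) => -[? ->] //; lra. Qed.

Lemma clamp_id l u t : l <= t <= u -> clamp l u t = t.
Proof.
move=> lt; have lu : l <= u by lra.
by case: (clampP t lu) => -[? ->] //; lra.
Qed.

Lemma clamp_dist l u s t : l <= u -> `|clamp l u s - clamp l u t| <= `|s - t|.
Proof.
move=> lu; rewrite ler_norml; have := ler_norm (s - t).
have := ler_norm (t - s); rewrite (distrC t).
by case: (clampP s lu) => -[? ->]; case: (clampP t lu) => -[? ->]; lra.
Qed.

(** At an endpoint the alternative depends on the side of [s], so it stands under the quantifier on
    [s]; this is how one-sided derivatives are glued. *)
Lemma clamp_near l u t : l < u -> exists2 e, 0 < e & forall s, `|s - t| < e ->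
  clamp l u s = clamp l u t \/ (l <= s <= u /\ l <= t <= u).
Proof.
move=> lu; have lu' := ltW lu.
have [tl|lt] := ltP t l.
  exists (l - t) => [|s]; first by lra.
  by rewrite ltr_norml => ?; left; rewrite /clamp !ifT //; lra.
have [ut|tu] := ltP u t.
  exists (t - u) => [|s]; first by lra.
  rewrite ltr_norml => ?; left.
  by case: (clampP s lu') => -[? ->]; case: (clampP t lu') => -[? ->]; lra.
have [tl|tl] := eqVneq t l.
  exists (u - l) => [|s]; first by lra.
  rewrite tl ltr_norml => ?; case: (clampP s lu') => -[? ->].
  - by left; rewrite clamp_id //; lra.
  - by right; lra.
  - by lra.
have [tu'|tu'] := eqVneq t u.
  exists (u - l) => [|s]; first by lra.
  rewrite tu' ltr_norml => ?; case: (clampP s lu') => -[? ->].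
  - by lra.
  - by right; lra.
  - by left; rewrite clamp_id //; lra.
have lt' : l < t by rewrite lt_neqAle eq_sym tl.
have tu2 : t < u by rewrite lt_neqAle tu'.
exists (Num.min (t - l) (u - t)) => [|s].
  by rewrite lt_min; lra.
by rewrite lt_min !ltr_norml => ?; right; lra.
Qed.

End clamp.

Section extension.
Context {R : realType}.
Implicit Types (u k : R -> R) (b l t : R).

(** Division-free form of the derivative, in which [s = t] is no exception. *)
Definition deriv_at_within (D : set R) u t l : Prop :=
  forall e, 0 < e -> exists2 c, 0 < c & forall s, D s -> `|s - t| < c ->
    `|u s - u t - l * (s - t)| <= e * `|s - t|.

Lemma derive_withinP (D : set R) u t : derivable_within D u t ->
  deriv_at_within D u t (derive_within D u t).
Proof.
move=> du e e0.
have : (u s - u t) / (s - t) @[s --> within D t^'] --> derive_within D u t by [].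
move=> /cvgrPdist_lt /(_ e e0).
rewrite !near_withinE => /nbhs_ballP[c /= c0 hc].
exists c => // s Ds st; have [->|neq] := eqVneq s t.
  by rewrite !subrr mulr0 subrr normr0 mulr0.
have nst : s - t != 0 by rewrite subr_eq0.
have : `|derive_within D u t - (u s - u t) / (s - t)| < e.
  by apply: hc => //=; rewrite -ball_normE /= distrC.
move=> /ltW /(ler_wpM2r (normr_ge0 (s - t))); rewrite -normrM mulrBl divfK //.
by rewrite distrC.
Qed.

Lemma deriv_at_is_derive u t l : deriv_at_within setT u t l -> is_derive t 1 u l.
Proof.
move=> h.
have lim1 : (fun x => x^-1 *: ((u \o shift t) (x *: 1) - u t)) x @[x --> 0^'] --> l.
  apply/cvgrPdist_le => e e0; have [c c0 hc] := h e e0.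
  rewrite near_withinE; apply/nbhs_ballP; exists c => // x /=.
  rewrite -ball_normE /= sub0r normrN => xc x0.
  have := hc (x + t) I; rewrite addrK => /(_ xc).
  rewrite /shift /= /GRing.scale /= mulr1 => hx.
  have nx : 0 < `|x| by rewrite normr_gt0.
  rewrite -(ler_pM2r nx) -normrM mulrBl mulrAC mulVf // mul1r distrC.
  by rewrite [leRHS]mulrC mulrC in hx *.
by split; [apply: cvgP lim1 | exact: cvg_lim lim1].
Qed.

(** Outside [[0, b]] this is a quadratic polynomial at the nearest endpoint. With [k = u2 / 2] the
    second derivative is frozen at its endpoint value, so its bounds, sign and Lipschitz constant
    survive. *)
Definition extend b u u1 k t : R :=
  let c := clamp 0 b t in u c + u1 c * (t - c) + k c * (t - c) ^+ 2.

Lemma is_derive_extend b u u1 k t : 0 < b ->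
  (forall s, 0 <= s <= b -> deriv_at_within `[0, b]%classic u s (u1 s)) ->
  is_derive t 1 (extend b u u1 k)
    (u1 (clamp 0 b t) + 2 * k (clamp 0 b t) * (t - clamp 0 b t)).
Proof.
move=> b0 du; apply: deriv_at_is_derive => e e0.
have [c1 c10 hc1] := clamp_near t b0.
set K := `|k (clamp 0 b t)| + 1.
have K0 : 0 < K by rewrite ltr_wpDl.
have [c2 c20 hc2] : exists2 c, 0 < c & forall s, `|s - t| < c ->
    0 <= s <= b -> 0 <= t <= b -> `|u s - u t - u1 t * (s - t)| <= e * `|s - t|.
  have [tb|tb] := boolP (0 <= t <= b); last by exists 1 => // s _ _; rewrite (negPf tb).
  have [c c0 hc] := du t tb e e0; exists c => // s st sb _.
  by apply: hc => //=; rewrite in_itv.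
(* [e / K] absorbs the remainder [k c * (s - t) ^+ 2] where the clamped value is constant. *)
exists (Num.min (Num.min c1 c2) (e / K)) => [|s _].
  by rewrite !lt_min c10 c20 divr_gt0.
rewrite !lt_min => /andP[/andP[sc1 sc2] se].
have [cst|[sb tb]] := hc1 _ sc1.
  rewrite /extend cst /=; set c := clamp 0 b t.
  have -> : u c + u1 c * (s - c) + k c * (s - c) ^+ 2 -
     (u c + u1 c * (t - c) + k c * (t - c) ^+ 2) -
     (u1 c + 2 * k c * (t - c)) * (s - t) = k c * (s - t) * (s - t).
    by ring.
  rewrite normrM ler_wpM2r // normrM.
  apply: (@le_trans _ _ (K * `|s - t|)).
    by rewrite ler_wpM2r // /K lerDl.
  by rewrite mulrC -ler_pdivlMr // ltW.
rewrite /extend /= !clamp_id // !subrr expr0n /= !mulr0 !addr0.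
exact: hc2.
Qed.

Lemma extend_id b u u1 k t : 0 <= t <= b -> extend b u u1 k t = u t.
Proof. by move=> tb; rewrite /extend clamp_id //= subrr expr0n /= !mulr0 !addr0. Qed.

Lemma extend_derivs b u u1 u2 : 0 < b ->
  (forall s, 0 <= s <= b -> deriv_at_within `[0, b]%classic u s (u1 s)) ->
  (forall s, 0 <= s <= b -> deriv_at_within `[0, b]%classic u1 s (u2 s)) ->
  has_derivs (extend b u u1 (fun t => u2 t / 2)) (extend b u1 u2 (cst 0))
    (u2 \o clamp 0 b).
Proof.
move=> b0 du du1; split=> t.
  rewrite (_ : extend b u1 u2 (cst 0) t = u1 (clamp 0 b t)
    + 2 * (u2 (clamp 0 b t) / 2) * (t - clamp 0 b t)).
    exact: is_derive_extend.
  by rewrite /extend /=; field.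
rewrite (_ : (u2 \o clamp 0 b) t =
    u2 (clamp 0 b t) + 2 * cst 0 (clamp 0 b t) * (t - clamp 0 b t)).
  exact: is_derive_extend.
by rewrite /= mulr0 mul0r addr0.
Qed.

Lemma deriv_at_within_bound b u l t c : 0 < b -> 0 <= t <= b ->
  deriv_at_within `[0, b]%classic u t l ->
  (forall s, 0 <= s <= b -> `|u s - u t| <= c * `|s - t|) -> `|l| <= c.
Proof.
move=> b0 tb du lip; apply/ler_addgt0Pr => e e0.
have [x x0 hx] := du e e0.
(* The test point is taken towards the farther endpoint, at distance at most [b / 2], to stay in the
   interval. *)
have [s [sb st sx]] : exists s, [/\ 0 <= s <= b, s != t & `|s - t| < x].
  have [tb2|tb2] := ltP t (b / 2).
    pose y := Num.min (x / 2) (b / 2).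
    have y0 : 0 < y by rewrite lt_min; lra.
    have yx : y <= x / 2 by rewrite ge_min lexx.
    have yb : y <= b / 2 by rewrite ge_min lexx orbT.
    exists (t + y); split; first by lra.
      by rewrite gt_eqF //; lra.
    by rewrite addrAC subrr add0r gtr0_norm //; lra.
  pose y := Num.min (x / 2) (b / 2).
  have y0 : 0 < y by rewrite lt_min; lra.
  have yx : y <= x / 2 by rewrite ge_min lexx.
  have yb : y <= b / 2 by rewrite ge_min lexx orbT.
  exists (t - y); split; first by lra.
    by rewrite lt_eqF //; lra.
  by rewrite addrAC subrr add0r normrN gtr0_norm //; lra.
have n0 : 0 < `|s - t| by rewrite normr_gt0 subr_eq0.
rewrite -(ler_pM2r n0) -normrM.
have := hx s; rewrite /= in_itv /= => /(_ sb sx) h1.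
have := lip s sb; rewrite mulrDl.
have := ler_normB (u s - u t) (u s - u t - l * (s - t)).
by rewrite opprB addrC subrK; lra.
Qed.

(** By the intermediate value theorem, a change of sign would force a zero. *)
Lemma lipschitz_sign u c K : 0 < c -> 
  (forall s t, `|u s - u t| <= K * `|s - t|) ->
  (forall t, c <= `|u t|) -> (forall t, c <= u t) \/ (forall t, u t <= - c).
Proof.
move=> c0 lip uc.
have [neg|/existsNP[s us]] := pselect (forall t, u t <= - c); first by right.
left=> t; move/negP: us; rewrite -ltNge => us.
have us' : c <= u s.
  by have := uc s; rewrite ler_normr => /orP[|] //; lra.
rewrite leNgt; apply/negP => ut.
have ut' : u t <= - c by have := uc t; rewrite ler_normr => /orP[|]; lra.
have cont (D : set R) : {within D, continuous u}.
  apply: continuous_subspaceT => x; apply/cvgrPdist_le => e e0.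
  have K0 : 0 < `|K| + 1 by rewrite ltr_wpDl.
  apply/nbhs_ballP; exists (e / (`|K| + 1)) => /=; first by rewrite divr_gt0.
  move=> y /=; rewrite ltr_pdivlMr // => xy.
  apply: le_trans (lip _ _) _; have := ler_norm K; have := normr_ge0 (x - y); nra.
have [st|ts] := leP s t.
  have [|x _ ux] := @IVT _ u s t 0 st (cont _).
    by rewrite ge_min le_max; apply/andP; split; apply/orP; [right|left]; lra.
  by have := uc x; rewrite ux normr0; lra.
have [|x _ ux] := @IVT _ u t s 0 (ltW ts) (cont _).
  by rewrite ge_min le_max; apply/andP; split; apply/orP; [left|right]; lra.
by have := uc x; rewrite ux normr0; lra.
Qed.

End extension.

(** * The quantities attached to g *)

Section extraction.
Context {R : realType}.
Implicit Types (A D : set R) (h : R -> R -> R).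

Lemma sup_norm_ge0 A D h : A !=set0 -> D !=set0 -> (0 <= sup_norm A D h)%E.
Proof.
move=> [a Aa] [t Dt]; apply: (@le_trans _ _ (`|h a t|%:E)).
  by rewrite lee_fin.
by apply: ereal_sup_ubound; exists (a, t).
Qed.

Lemma lip_norm_ge0 A D h : A !=set0 ->
  (exists s t, [/\ D s, D t & s <> t]) -> (0 <= lip_norm A D h)%E.
Proof.
move=> [a Aa] [s [t [Ds Dt st]]].
apply: (@le_trans _ _ (`|h a s - h a t| / (`|a - a| + `|s - t|))%:E).
  by rewrite lee_fin divr_ge0 // addr_ge0.
apply: ereal_sup_ubound; exists (a, t), (a, s); split=> //.
by case.
Qed.

Lemma lip_norm_bound A D h (N a a' t t' : R) : (lip_norm A D h <= N%:E)%E ->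
  A a -> A a' -> D t -> D t' ->
  `|h a' t' - h a t| <= N * (`|a' - a| + `|t' - t|).
Proof.
move=> hN Aa Aa' Dt Dt'.
have [[-> ->]|ne] := pselect ((a', t') = (a, t)).
  by rewrite !subrr normr0 addr0 mulr0.
have pos : 0 < `|a' - a| + `|t' - t|.
  rewrite lt0r addr_ge0 // andbT paddr_eq0 // !normr_eq0 !subr_eq0.
  by apply/negP => /andP[/eqP e1 /eqP e2]; apply: ne; rewrite e1 e2.
rewrite -ler_pdivrMr // -lee_fin; apply: le_trans hN.
by apply: ereal_sup_ubound; exists (a, t), (a', t').
Qed.

Lemma inf_abs_le A D h a t : A a -> D t -> (inf_abs A D h <= `|h a t|%:E)%E.
Proof. by move=> Aa Dt; apply: ereal_inf_lbound; exists (a, t). Qed.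

(** The infimum over the compact rectangle is attained. Composing with [clamp] makes the function
    continuous on the whole plane. *)
Lemma inf_abs_gt0 h (al be b K : R) : al <= be -> 0 <= b ->
  (forall a a' t t', al <= a <= be -> al <= a' <= be -> 0 <= t <= b ->
    0 <= t' <= b -> `|h a' t' - h a t| <= K * (`|a' - a| + `|t' - t|)) ->
  (forall a t, al <= a <= be -> 0 <= t <= b -> h a t <> 0) ->
  (0 < inf_abs `[al, be]%classic `[0%R, b]%classic h)%E.
Proof.
move=> ab b0 lip nz.
pose u (p : R * R) := `|h (clamp al be p.1) (clamp 0 b p.2)|.
have cu : continuous u.
  move=> p; apply/cvgrPdist_le => e e0.
  have K0 : 0 < 2 * `|K| + 1 by rewrite ltr_wpDl // mulr_ge0.
  have e'0 : 0 < e / (2 * `|K| + 1) by rewrite divr_gt0.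
  apply: filterS (nbhsx_ballx p _ e'0) => r [/= r1 r2].
  have r1' : `|p.1 - r.1| * (2 * `|K| + 1) < e.
    by move: r1; rewrite -ball_normE /= ltr_pdivlMr.
  have r2' : `|p.2 - r.2| * (2 * `|K| + 1) < e.
    by move: r2; rewrite -ball_normE /= ltr_pdivlMr.
  apply: le_trans (ler_dist_dist _ _) _.
  apply: le_trans (lip _ _ _ _ _ _ _ _) _; try exact: clamp_itv.
  have := clamp_dist p.1 r.1 ab; have := clamp_dist p.2 r.2 b0.
  have := normr_ge0 (clamp al be p.1 - clamp al be r.1).
  have := normr_ge0 (clamp 0 b p.2 - clamp 0 b r.2).
  have := ler_norm K; have := normr_ge0 K.
  move: (clamp al be _ - _) (clamp 0 b _ - _) => x y; nra.
have cpt : compact (`[al, be]%classic `*` `[0, b]%classic : set (R * R)).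
  by apply: compact_setX; exact: segment_compact.
have ne : (`[al, be]%classic `*` `[0, b]%classic : set (R * R)) !=set0.
  by exists (al, 0); split; rewrite /= in_itv /= ?lexx.
have [[a0 t0]] := compact_EVT_min ne cpt (continuous_subspaceT cu).
rewrite inE => -[/=]; rewrite !in_itv /= => Aa0 Dt0 hmin.
apply: (@lt_le_trans _ _ `|h a0 t0|%:E).
  by rewrite lte_fin normr_gt0; apply/eqP; exact: nz.
apply: le_ereal_inf_tmp => _ [[a t] [/= Aa Dt] <-].
rewrite in_itv /= in Aa; rewrite in_itv /= in Dt.
rewrite lee_fin; have := hmin (a, t).
rewrite inE /u /= !clamp_id //; apply; split; by rewrite /= in_itv.
Qed.

(** The value [+oo] arises when [A] is a single point; any positive real then serves, and 1 is
    chosen. *)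
Definition lambda2_real (l : \bar R) : R := if l == +oo%E then 1 else fine l.

Lemma lambda2_real_gt0 (l : \bar R) : (0 < l)%E -> 0 < lambda2_real l.
Proof. by rewrite /lambda2_real; case: l => [r||] //=; rewrite lte_fin. Qed.

Lemma lambda2_bound A D g a a' t : (0 < lambda2 A D g)%E ->
  A a -> A a' -> D t ->
  lambda2_real (lambda2 A D g) * `|a' - a| <=
  `|partial_t D (partial_t D g) a' t - partial_t D (partial_t D g) a t|.
Proof.
move=> l0 Aa Aa' Dt; set gtt := partial_t D _.
have [->|ne] := eqVneq a' a; first by rewrite !subrr normr0 mulr0.
have n0 : 0 < `|a' - a| by rewrite normr_gt0 subr_eq0.
have : (lambda2 A D g <= (`|gtt a' t - gtt a t| / `|a' - a|)%:E)%E.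
  apply: ereal_inf_lbound; exists t, a, a'; split=> //; first exact/eqP.
  by rewrite normrM normfV.
rewrite -ler_pdivlMr //; move: l0; rewrite /lambda2_real.
by case: (lambda2 A D g) => [r||] //=; rewrite lee_fin.
Qed.

End extraction.

(** The three terms of the minimum secure [eps <= b] and the two smallness conditions of
    [fin_cover_Gamma]. *)
Definition radius_const {R : realType} (n : nat) (b : R) (reg inf lam2 : \bar R) : R :=
  let N := fine reg + 1 in
  Num.min b (Num.min (fine inf / (160 * n.-1%:R * N))
    (lambda2_real lam2 * fine inf / (320 * n.-1%:R * N ^+ 2))).

Definition volume_const {R : realType} (n : nat) (b : R) (reg inf lam2 : \bar R) : R :=
  `|cover_const n.-1 (fine reg + 1) (lambda2_real lam2)
     (radius_const n b reg inf lam2)| + 1.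

Theorem theorem1p7 (R : realType) :
  exists K_eps K_C : nat -> R -> \bar R -> R -> \bar R -> \bar R -> R,
  forall (n : nat) (alpha beta b L : R) (g : R -> R -> R),
    (3 <= n)%N -> alpha <= beta -> 0 < b <= 1 ->
    nondegenerate_near_origin `[alpha, beta]%classic b g L ->
    let A : set R := `[alpha, beta]%classic in
    let I : set R := `[0, b]%classic in
    let inf_gtt := inf_abs A I (partial_t I (partial_t I g)) in
    exists eps C : R,
      [/\ 0 < eps <= b,
          0 < C,
          eps^-1 <= K_eps n b (reg_norm A I g) L inf_gtt (lambda2 A I g),
          C <= K_C n b (reg_norm A I g) L inf_gtt (lambda2 A I g) &
          forall a a' : R, A a -> A a' ->
          forall delta : R, 0 < delta < 1 ->
            (ereal_sup [set lebesgue_rV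
               (translate (nbhd (Gamma n g a b) delta) tau
                `&` nbhd (Gamma n g a' eps) delta) | tau in setT]
             <= (C * (delta ^+ 2 / (delta + `|a' - a|)))%:E)%E].
Proof.
exists (fun n b reg _ inf lam2 => (radius_const n b reg inf lam2)^-1),
  (fun n b reg _ inf lam2 => volume_const n b reg inf lam2).
move=> n alpha beta b L g n3 ab /andP[b0 b1] nondeg A I inf_gtt.
set reg := reg_norm A I g; set lam2 := lambda2 A I g.
have [[dg dgt reg_fin _ _] gt0 [gtt_neq0 lam2_gt0]] := nondeg.
set gt := partial_t I g in dgt gt0 gtt_neq0.
set gtt := partial_t I gt in gtt_neq0 inf_gtt *.
have inI t : 0 <= t <= b -> I t by move=> tb; rewrite /I /= in_itv.
have inA a : alpha <= a <= beta -> A a by move=> aab; rewrite /A /= in_itv.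
have A0 : A !=set0 by exists alpha; apply: inA; rewrite lexx.
have I2 : exists s t, [/\ I s, I t & s <> t].
  by exists 0, b; split; [apply: inI; lra|apply: inI; lra|]; lra.
have I0 : I !=set0 by have [s [_ [Is _ _]]] := I2; exists s.
have sup0 := sup_norm_ge0 gt A0 I0.
have lip0 := lip_norm_ge0 gt A0 I2; have lip0' := lip_norm_ge0 gtt A0 I2.
have reg_num : reg \is a fin_num.
  by rewrite ge0_fin_numE // !adde_ge0.
(* The added 1 ensures [N >= 1]; as the summands of the norm are nonnegative, [N] dominates the
   Lipschitz constants of [gt] and [gtt]. *)
set N := fine reg + 1.
have regN : (reg <= N%:E)%E by rewrite -(fineK reg_num) lee_fin /N; lra.
have N1 : 1 <= N by rewrite /N lerDr fine_ge0 // !adde_ge0.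
have N0 : 0 < N by lra.
have lipgt : (lip_norm A I gt <= N%:E)%E.
  by apply: le_trans regN; apply: le_trans (leeDr _ sup0) (leeDl _ lip0').
have lipgtt : (lip_norm A I gtt <= N%:E)%E.
  by apply: le_trans regN; apply: leeDr; rewrite adde_ge0.
have derg a t : A a -> 0 <= t <= b -> deriv_at_within I (g a) t (gt a t).
  by move=> Aa /inI It; apply: derive_withinP; exact: dg.
have dergt a t : A a -> 0 <= t <= b -> deriv_at_within I (gt a) t (gtt a t).
  by move=> Aa /inI It; apply: derive_withinP; exact: dgt.
have gtt_lip a a' t t' : A a -> A a' -> 0 <= t <= b -> 0 <= t' <= b ->
    `|gtt a' t' - gtt a t| <= N * (`|a' - a| + `|t' - t|).
  by move=> Aa Aa' /inI It /inI It'; exact: lip_norm_bound lipgtt _ _ _ _.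
(* [gtt] is bounded by the Lipschitz constant of [gt] in its second variable. *)
have gtt_le a t : A a -> 0 <= t <= b -> `|gtt a t| <= N.
  move=> Aa tb; apply: (deriv_at_within_bound b0 tb (dergt _ _ Aa tb)) => s sb.
  have := lip_norm_bound lipgt Aa Aa (inI _ tb) (inI _ sb).
  by rewrite subrr normr0 add0r.
have inf_gt0 : (0 < inf_gtt)%E.
  apply: (@inf_abs_gt0 _ _ _ _ _ N ab (ltW b0)) => [a a' t t' Aa Aa'|a t Aa tb].
  - by apply: gtt_lip; exact: inA.
  - by apply: gtt_neq0; [exact: inA|exact: inI].
have inf_le a t : A a -> 0 <= t <= b -> (inf_gtt <= `|gtt a t|%:E)%E.
  by move=> Aa /inI It; exact: inf_abs_le.
have b00 : (0 : R) <= 0 <= b by rewrite lexx ltW.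
have inf_num : inf_gtt \is a fin_num.
  rewrite ge0_fin_numE ?(ltW inf_gt0) //.
  have Aal : A alpha by apply: inA; rewrite lexx.
  by apply: le_lt_trans (inf_le _ _ Aal b00) _; rewrite ltry.
set m := fine inf_gtt.
have infE : inf_gtt = m%:E by rewrite fineK.
have m0 : 0 < m by rewrite -lte_fin -infE.
set lam := lambda2_real lam2; have lam0 : 0 < lam by exact: lambda2_real_gt0.
have D0 : 0 < n.-1%:R :> R by rewrite ltr0n; case: (n) n3 => [|[]].
set eps := radius_const n b reg inf_gtt lam2.
have k1 : 0 < 160 * n.-1%:R * N by rewrite !mulr_gt0.
have k2 : 0 < 320 * n.-1%:R * N ^+ 2 by rewrite !mulr_gt0 // exprn_gt0.
have eps_b : 0 < eps <= b.
  rewrite /eps /radius_const -/N -/m -/lam ge_min lexx /= andbT !lt_min b0 /=.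
  by rewrite !divr_gt0 // mulr_gt0.
have eps_m : 160 * n.-1%:R * N * eps <= m.
  rewrite mulrC -ler_pdivlMr // /eps /radius_const -/N -/m.
  by rewrite !ge_min lexx orbT.
have eps_lam : 320 * n.-1%:R * N ^+ 2 * eps <= lam * m.
  rewrite mulrC -ler_pdivlMr // /eps /radius_const -/N -/m -/lam.
  by rewrite !ge_min lexx !orbT.
exists eps, (volume_const n b reg inf_gtt lam2); split=> //.
  by rewrite /volume_const ltr_wpDl.
move=> a a' Aa Aa' delta delta01.
apply: ge_ereal_sup => _ [tau _ <-]; apply: fin_cover_lebesgue.
  by rewrite addn1.
have cl t : 0 <= clamp 0 b t <= b by apply: clamp_itv; exact: ltW.
have derivs c : A c -> has_derivs (extend b (g c) (gt c) (fun t => gtt c t / 2))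
    (extend b (gt c) (gtt c) (cst 0)) (gtt c \o clamp 0 b).
  by move=> Ac; apply: extend_derivs => // s sb; [exact: derg|exact: dergt].
have F10 c : A c -> extend b (gt c) (gtt c) (cst 0) 0 = 0.
  by move=> Ac; rewrite extend_id // gt0.
have F2lip c s t : A c ->
    `|(gtt c \o clamp 0 b) s - (gtt c \o clamp 0 b) t| <= N * `|s - t|.
  move=> Ac; apply: le_trans (gtt_lip _ _ _ _ Ac Ac (cl _) (cl _)) _.
  by rewrite subrr normr0 add0r ler_wpM2l ?(ltW N0) // clamp_dist // ltW.
apply: (fin_cover_Gamma tau n3 N1 m0 lam0 eps_b b1 eps_m eps_lam
  (derivs _ Aa) (derivs _ Aa') (F10 _ Aa) (F10 _ Aa')) => //.
- by move=> t; exact: gtt_le.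
- by move=> t; exact: gtt_le.
- by move=> s t; exact: F2lip.
- move=> t /=; apply: le_trans (gtt_lip _ _ _ _ Aa Aa' (cl _) (cl _)) _.
  by rewrite subrr normr0 addr0.
- apply: (lipschitz_sign m0) => [s t|t]; first exact: F2lip.
  by rewrite -lee_fin -infE; exact: inf_le.
(* For [a' = a] both sides vanish. Otherwise [lambda2_bound] keeps the difference away from 0, and
   continuity makes its sign independent of [t]. *)
- have [->|ne] := eqVneq a' a.
    by left=> t; rewrite !subrr normr0 mulr0.
  have c0 : 0 < lam * `|a' - a| by rewrite mulr_gt0 // normr_gt0 subr_eq0.
  apply: (@lipschitz_sign _ (fun t => _ t - _ t) _ (N + N) c0) => [s t|t].
    have := F2lip _ s t Aa; have := F2lip _ s t Aa'.
    by rewrite /= !ler_norml [(N + N) * _]mulrDl; lra.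
  exact: lambda2_bound lam2_gt0 Aa Aa' (inI _ (cl t)).
- by move=> t tb; rewrite extend_id.
- by move=> t tb; rewrite extend_id.
Qed.
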